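(* $\sup_{d\ge 4} p_d \le 27/100$, where the supremum is over integers $d\ge 4$ and $p_d$ is the critical drift of the frog model with drift on the rooted $d$-ary tree.
   Context: For an integer $d\ge 2$ let $\mathbb T_d$ be the infinite rooted $d$-ary tree (each vertex has $d$ children) with root $\varnothing$. For $p\in(0,1)$ the frog model with drift $\mathrm{FM}(d,p)$ on $\mathbb T_d$ is as follows. Initially there is one active particle at $\varnothing$ and one dormant particle at each non-root vertex. In discrete time, every active particle independently performs a $p$-biased nearest neighbor random walk: at each time step, from a non-root vertex it moves one step towards the root (to the parent) with probability $p$, and with probability $1-p$ it moves away from the root to a uniformly sampled child vertex; from the root it moves to a uniformly sampled child. When an active particle moves to a site containing a dormant particle, the dormant particle becomes active and begins its own independent $p$-biased random walk. A root visit is counted each time an active particle moves to the root; $V_{\mathrm{FM}(d,p)}\in\{0,1,\dots\}\cup\{\infty\}$ is the total number of root visits over all time. $\mathrm{FM}(d,p)$ is recurrent if $\mathbf P(V_{\mathrm{FM}(d,p)}=\infty)=1$. Define $p_d=\inf\{p\in(0,1):\mathrm{FM}(d,p)\text{ is recurrent}\}$. *)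

(* Defs.v *)
From mathcomp Require Import all_boot all_order all_algebra.
From mathcomp Require Import all_classical all_reals all_analysis.

Set Implicit Arguments.
Unset Strict Implicit.
Unset Printing Implicit Defensive.

Import Order.TTheory GRing.Theory Num.Theory.

Local Open Scope classical_set_scope.
Local Open Scope ring_scope.

(* Vertices of the rooted d-ary tree are words over 'I_d, with the most recent
   letter first: [::] is the root, the children of v are the words i :: v, and
   the parent of i :: v is v. *)
Notation vertex d := (seq 'I_d).

Definition is_child (d : nat) (v w : vertex d) : bool :=
  if w is _ :: u then u == v else false.

Definition step_prob (R : realType) (d : nat) (p : R) (v w : vertex d) : R :=
  match v with
  | [::] => if is_child v w then d%:R^-1 else 0
  | _ :: parent => if w == parent then p
                   else if is_child v w then (1 - p) / d%:R else 0
  end.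

Definition biased_walk (R : realType) (d : nat) (p : R) (disp : measure_display)
    (T : measurableType disp) (P : probability T R)
    (v : vertex d) (X : nat -> T -> vertex d) : Prop :=
  (forall k w, measurable [set t | X k t = w]) /\
  (forall (n : nat) (x : nat -> vertex d),
     P [set t | forall k, (k <= n)%N -> X k t = x k] =
     ((x 0%N == v)%:R * \prod_(k < n) step_prob p (x k) (x k.+1))%:E).

Definition walk_sigma (d : nat) (T : Type) (X : nat -> T -> vertex d) :
    set (set T) :=
  <<s [set E | exists k w, E = [set t | X k t = w]] >>.

Definition mutually_independent (R : realType) (disp : measure_display)
    (T : measurableType disp) (P : probability T R) (I : choiceType)
    (F : I -> set (set T)) : Prop :=
  forall (s : seq I) (A : I -> set T), uniq s ->
    (forall i, i \in s -> F i (A i)) ->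
    P (\bigcap_(i in [set` s]) A i) = (\prod_(i <- s) P (A i))%E.

(* The k-th step of the frog starting at v is counted from its activation: it
   stands at X v k t when it has been active for k units of time. *)
Definition frog_walks (R : realType) (d : nat) (p : R) (disp : measure_display)
    (T : measurableType disp) (P : probability T R)
    (X : vertex d -> nat -> T -> vertex d) : Prop :=
  (forall v, biased_walk p P v (X v)) /\
  mutually_independent P (fun v => walk_sigma (X v)).

(* age S n v is None if at time n the frog starting at v is dormant (and at v),
   and Some k if it has been active for k units of time (and is at S v k). *)
Fixpoint age (d : nat) (S : vertex d -> nat -> vertex d) (n : nat)
    (v : vertex d) : option nat :=
  match n with
  | 0%N => if v == [::] then Some 0%N else None
  | m.+1 =>
    match age S m v with
    | Some k => Some k.+1
    | None => if `[< exists u k, age S m u = Some k /\ S u k.+1 = v >]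
              then Some 0%N else None
    end
  end.

(* The pairs (n, u) such that the frog starting at u is active at time n and its
   next step, made between the times n and n.+1, takes it to the root. *)
Definition root_visit_set (d : nat) (S : vertex d -> nat -> vertex d) :
    set (nat * vertex d) :=
  [set e | exists k, age S e.1 e.2 = Some k /\ S e.2 k.+1 = [::]].

Definition root_visits (R : realType) (d : nat)
    (S : vertex d -> nat -> vertex d) : \bar R :=
  counting (root_visit_set S).

(* The law of the walks determines that of the number of root visits, so
   quantifying over all their realizations amounts to considering one. *)
Definition recurrent (R : realType) (d : nat) (p : R) : Prop :=
  forall (disp : measure_display) (T : measurableType disp)
    (P : probability T R) (X : vertex d -> nat -> T -> vertex d),
    frog_walks p P X ->
    P [set t | root_visits R (fun v k => X v k t) = +oo%E] = 1%E.

(* The infimum and the supremum are taken in the extended reals, where those of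
   empty or unbounded sets have their usual values (they default to 0 in R). *)
Definition critical_drift (R : realType) (d : nat) : \bar R :=
  ereal_inf [set p%:E | p in [set p : R | 0 < p < 1 /\ recurrent d p]].

(* Main.v *)
From Corelib Require Import BinNums.
From Stdlib Require BinInt.
Require Import Defs.
From mathcomp Require Import all_boot all_order all_algebra.
From mathcomp Require Import all_classical all_reals all_analysis.
From mathcomp Require Import ssrZ lra ring zify.

Set Implicit Arguments.
Unset Strict Implicit.
Unset Printing Implicit Defensive.

Import Order.TTheory GRing.Theory Num.Theory.

Local Open Scope classical_set_scope.
Local Open Scope ring_scope.

(** We show that the drift [27/100] makes the model recurrent for every
    [d >= 4], so that it is an upper bound of every critical drift.

    The set of frogs that are ever woken, and the trajectories that they follow,
    do not depend on the order in which the steps of the walks are looked at.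
    The model can therefore be explored as a game: a position consists of the
    vertices visited so far, whose frogs are awake, and of the places where
    these frogs have been brought; the player chooses a frog that is awake and
    sees its next step.  Let [loss K] be the infimum over the strategies of the
    probability that fewer than [K] frogs are brought back to the root.  As the
    walks are independent and Markov, the probability that the root receives
    fewer than [K] visits is at most the loss of the initial position
    ([loss_le_sound]), and it is enough to prove that this loss is zero.

    The strategy is self-similar.  A frog at a vertex [y] is run until it is
    either at the parent of [y] or [N] generations below [y], where [N] is
    large.  By the ruin formula the first outcome has a probability close to
    [27/73], and in the second one the frog has visited a ray of length [N] that
    starts in a uniform child of [y] ([loss_run_child]).  If the subtree of that
    child has not been used, the ray starts there a copy of the whole process,
    which sends back to [y] a random number of frogs.  So let [returns n] be the
    law of the number of frogs that leave a subtree in which a ray of length [n]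
    has been visited: to sample [returns n.+1], run one after the other the frog
    of [y] and those that come back to [y] from the child on the ray; each of
    them either leaves the subtree, or opens a new child, which sends back an
    independent sample of [returns n], or is abandoned ([subtree_boundP]).
    Rounding the rates down to values that suit [d = 4] and never using more
    than four children makes one law serve all the [d >= 4] at once.

    It remains to see that [returns n] tends to infinity.  Each frog at [y] acts
    independently, so the generating function [f_n] of [returns n] satisfies a
    recursion that bounds [f_n.+1 x] by a polynomial in bounds of [f_n] at four
    points [theta i] ([returns_step]).  Jensen's inequality bounds the value of
    [f_n] at a point by a power of its value at another one
    ([expectation_jensen]), and with the two points [27/50] and [19/25] the
    recursion closes up: if [f_n (27/50) <= T ^ 11] and [f_n (19/25) <= T ^ 6],
    then the same holds for [f_n.+1] and [rho * T], where [rho < 1]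
    ([returns_decay]).  This is a pair of polynomial inequalities on [[0, 1]],
    which are checked by subdividing the interval ([nonneg_form]). *)

(** * The exploration game *)

Section Game.
Variables (R : realType) (d : nat) (p : R).
Hypothesis d_gt0 : (0 < d)%N.
Hypothesis p01 : 0 < p < 1.

Definition nbrs (v : vertex d) : seq (vertex d) :=
  (if v is _ :: u then [:: u] else [::]) ++ [seq i :: v | i <- enum 'I_d].

Definition move (v : vertex d) (g : vertex d -> R) : R :=
  \sum_(w <- nbrs v) step_prob p v w * g w.

Lemma childNparent (i : 'I_d) (u : vertex d) : (i :: u == u) = false.
Proof. by apply/eqP => /(congr1 size) /= /eqP; rewrite eqn_leq ltnn. Qed.

Lemma grandchildNself (i j : 'I_d) (u : vertex d) : (i :: j :: u == u) = false.
Proof. by apply/eqP => /(congr1 size) /= /eqP; rewrite eqn_leq ltnNge leqnSn. Qed.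

Lemma move_root g : move [::] g = \sum_(i < d) d%:R^-1 * g [:: i].
Proof. by rewrite /move /nbrs /= big_map big_enum. Qed.

Lemma move_cons j u g : move (j :: u) g =
  p * g u + \sum_(i < d) (1 - p) / d%:R * g (i :: j :: u).
Proof.
rewrite /move /nbrs /= big_cons eqxx big_map big_enum /=; congr (_ + _).
by apply: eq_bigr => i _; rewrite grandchildNself eqxx.
Qed.

Let dR : d%:R != 0 :> R.
Proof. by rewrite pnatr_eq0 -lt0n. Qed.

Lemma step_prob_ge0 (v w : vertex d) : 0 <= step_prob p v w.
Proof.
have /andP[p0 p1] := p01.
case: v => [|j u] /=; first by case: ifP; rewrite ?invr_ge0 ?ler0n.
case: ifP => _; first exact: ltW.
by case: ifP => _ //; rewrite divr_ge0 ?ler0n // subr_ge0 ltW.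
Qed.

Lemma move_const v c : move v (fun=> c) = c.
Proof.
have dc e : \sum_(i < d) e / d%:R * c = e * c.
  by rewrite sumr_const card_ord -mulr_natr; field.
case: v => [|j u]; last by rewrite move_cons dc; ring.
by rewrite move_root -[RHS]mul1r -(dc 1); apply: eq_bigr => i _; rewrite div1r.
Qed.

Lemma ler_move v g g' : (forall w, g w <= g' w) -> move v g <= move v g'.
Proof. by move=> le; apply: ler_sum => w _; rewrite ler_wpM2l ?step_prob_ge0. Qed.

Lemma moveD v g g' : move v (fun w => g w + g' w) = move v g + move v g'.
Proof. by rewrite -big_split; apply: eq_bigr => w _; rewrite mulrDr. Qed.

(** In a position [(Vis, pos)] of the game, [pos u] is the place of the frog
    that started at [u], which is awake when [u \in Vis]. *)
Definition relocate (pos : vertex d -> vertex d) (u w : vertex d) :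
  vertex d -> vertex d := fun v => if v == u then w else pos v.

Lemma relocate_at pos u w : relocate pos u w u = w.
Proof. by rewrite /relocate eqxx. Qed.

Lemma relocate_other pos u w v : v != u -> relocate pos u w v = pos v.
Proof. by rewrite /relocate => /negPf ->. Qed.

Lemma relocate_twice pos u w w' :
  relocate (relocate pos u w) u w' = relocate pos u w'.
Proof. by apply/funext => v; rewrite /relocate; case: (v == u). Qed.

Lemma relocate_id pos u : relocate pos u (pos u) = pos.
Proof. by apply/funext => v; rewrite /relocate; case: eqP => // ->. Qed.

Variable K : nat.

Definition returned (Vis : seq (vertex d)) (pos : vertex d -> vertex d) : nat :=
  count (fun u => (u != [::]) && (pos u == [::])) (undup Vis).

(** [loss_le Vis pos q]: from the position [(Vis, pos)] some strategy returns
    fewer than [K] frogs with probability at most [q].  The premise of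
    [loss_move] ranges over all vertices rather than the neighbours, which is
    harmless because one may always stop with [q = 1]. *)
Inductive loss_le : seq (vertex d) -> (vertex d -> vertex d) -> R -> Prop :=
| loss_stop Vis pos q : (returned Vis pos < K)%:R <= q -> loss_le Vis pos q
| loss_move Vis pos u q q' : u \in Vis ->
    (forall w, loss_le (w :: Vis) (relocate pos u w) (q w)) ->
    move (pos u) q <= q' -> loss_le Vis pos q'.

Lemma loss_le_ge0 Vis pos q : loss_le Vis pos q -> 0 <= q.
Proof.
elim=> {Vis pos q} [Vis pos q|Vis pos u q q' _ _ q0]; apply: le_trans.
  exact: ler0n.
by rewrite -(move_const (pos u) 0) ler_move.
Qed.

Lemma returned_sub Vis Vis' pos : {subset Vis <= Vis'} ->
  (returned Vis pos <= returned Vis' pos)%N.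
Proof.
move=> sub; rewrite /returned -!size_filter; apply: uniq_leq_size.
  by rewrite filter_uniq ?undup_uniq.
by move=> u; rewrite !mem_filter !mem_undup => /andP[-> /sub].
Qed.

(** A strategy may ignore the frogs that are awake without its knowledge. *)
Lemma loss_le_sub Vis Vis' pos q : {subset Vis <= Vis'} ->
  loss_le Vis pos q -> loss_le Vis' pos q.
Proof.
move=> + le; elim: le Vis' =>
  {Vis pos q} [Vis pos q le|Vis pos u q q' uV _ IH le] Vis' sub.
  apply: loss_stop; apply: le_trans le; rewrite ler_nat.
  case: (ltnP (returned Vis' pos) K) => // lt.
  by rewrite (leq_ltn_trans (returned_sub pos sub) lt).
apply: (loss_move (u := u) (q := q)) => //; first exact: sub.
move=> w; apply: IH => v; rewrite !inE => /orP[->//|/sub ->]; exact: orbT.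
Qed.

Definition loss Vis pos : R := inf [set q | loss_le Vis pos q].

Let loss_has_inf Vis pos : has_inf [set q | loss_le Vis pos q].
Proof.
split; first by exists (returned Vis pos < K)%:R; exact: loss_stop.
by exists 0 => q; exact: loss_le_ge0.
Qed.

Lemma loss_ge0 Vis pos : 0 <= loss Vis pos.
Proof.
apply: lb_le_inf; first by have [] := loss_has_inf Vis pos.
by move=> q; exact: loss_le_ge0.
Qed.

Lemma ge_loss Vis pos q : loss_le Vis pos q -> loss Vis pos <= q.
Proof. by move=> le; apply: ge_inf => //; have [] := loss_has_inf Vis pos. Qed.

Lemma loss_approx Vis pos e : 0 < e ->
  exists2 q, loss_le Vis pos q & q <= loss Vis pos + e.
Proof.
move=> e0; have [q ? lt] := inf_adherent e0 (loss_has_inf Vis pos).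
by exists q => //; exact: ltW.
Qed.

Lemma loss_stop_le Vis pos : loss Vis pos <= (returned Vis pos < K)%:R.
Proof. by apply/ge_loss/loss_stop. Qed.

Lemma loss_sub Vis Vis' pos : {subset Vis <= Vis'} ->
  loss Vis' pos <= loss Vis pos.
Proof.
move=> sub; apply/ler_addgt0Pr => e e0; have [q le qe] := loss_approx Vis pos e0.
by apply: le_trans qe; apply: ge_loss; exact: loss_le_sub le.
Qed.

(** Dynamic programming: follow a nearly optimal strategy after each outcome of
    the next step. *)
Lemma loss_step Vis pos u : u \in Vis -> loss Vis pos <=
  move (pos u) (fun w => loss (w :: Vis) (relocate pos u w)).
Proof.
move=> uV; apply/ler_addgt0Pr => e e0.
have /choice[q qP] : forall w, exists q, loss_le (w :: Vis) (relocate pos u w) q /\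
    q <= loss (w :: Vis) (relocate pos u w) + e.
  by move=> w; have [q ? ?] := loss_approx (w :: Vis) (relocate pos u w) e0; exists q.
rewrite -[X in _ + X](move_const (pos u)) -moveD.
apply: ge_loss; apply: (loss_move (u := u) (q := q)) => //.
  by move=> w; have [] := qP w.
by apply: ler_move => w; have [] := qP w.
Qed.

(** * Running one frog *)

Fixpoint ray n (y : vertex d) (Vis : seq (vertex d)) : Prop :=
  y \in Vis /\ if n is m.+1 then exists i, ray m (i :: y) Vis else True.

Lemma ray_le m n y Vis : (m <= n)%N -> ray n y Vis -> ray m y Vis.
Proof.
elim: n m y => [|n IH] [|m] y //= le [yV]; first by split.
by case=> i ri; split => //; exists i; exact: IH.
Qed.

(** The ruin probability: a walk that starts at a vertex reaches the parent
    before going [n] generations down.  The recursion is the first step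
    analysis [q = p + (1 - p) * up_prob m * q]. *)
Fixpoint up_prob n : R :=
  if n is m.+1 then p / (1 - (1 - p) * up_prob m) else 0.

Lemma up_prob_bound n : 0 <= up_prob n < 1.
Proof.
have /andP[p0 p1] := p01.
elim: n => [|n /andP[h0 h1]] /=; first by rewrite lexx ltr01.
have c0 : 0 < 1 - (1 - p) * up_prob n by nra.
by rewrite divr_ge0 ?ltr_pdivrMr ?(ltW c0) ?(ltW p0) //=; nra.
Qed.

(** The frog is run until it is at the parent or [n] generations below.  When an
    excursion into a child ends, the frog is back where it started and only the
    set of visited vertices has grown, so that the loss [l] has not increased;
    this gives an inequality [l <= c + r * l] with [r < 1], however long the run
    may last. *)
Lemma loss_run n x' j Vis pos u a b : u \in Vis -> pos u = j :: x' ->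
  j :: x' \in Vis ->
  loss Vis (relocate pos u x') <= a ->
  (forall z Vis', {subset Vis <= Vis'} -> ray n (j :: x') Vis' ->
     loss Vis' (relocate pos u z) <= b) ->
  loss Vis pos <= up_prob n * a + (1 - up_prob n) * b.
Proof.
have /andP[p0 p1] := p01.
elim: n x' j Vis pos u a b => [|n IH] x' j Vis pos u a b uV pu xV la lb.
  rewrite /= mul0r add0r subr0 mul1r -[pos](relocate_id _ u).
  by apply: lb; rewrite /= ?xV.
set h := up_prob n in IH *; set l := loss Vis pos.
have /andP[h0 h1] : 0 <= h < 1 := up_prob_bound n.
have step : l <= p * a + (1 - p) * (h * l + (1 - h) * b).
  apply: le_trans (loss_step pos uV) _; rewrite pu move_cons lerD //.
    rewrite ler_wpM2l ?(ltW p0) //; apply: le_trans la.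
    by apply: loss_sub => v vV; rewrite inE vV orbT.
  have -> : (1 - p) * (h * l + (1 - h) * b) =
      \sum_(i < d) (1 - p) / d%:R * (h * l + (1 - h) * b).
    by rewrite sumr_const card_ord -[RHS]mulr_natr; field.
  apply: ler_sum => i _; rewrite ler_wpM2l ?divr_ge0 ?ler0n ?subr_ge0 ?(ltW p1) //.
  apply: (IH (j :: x') i _ _ u).
  - by rewrite inE uV orbT.
  - by rewrite relocate_at.
  - by rewrite inE eqxx.
  - rewrite relocate_twice -pu relocate_id; apply: loss_sub => v vV.
    by rewrite inE vV orbT.
  - move=> z Vis' sub r; rewrite relocate_twice; apply: lb => [v vV|/=].
      by rewrite sub // inE vV orbT.
    by split; [rewrite sub // inE xV orbT|exists i].
have c0 : 0 < 1 - (1 - p) * h by nra.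
have -> : up_prob n.+1 * a + (1 - up_prob n.+1) * b =
   (p * a + (1 - p) * (1 - h) * b) / (1 - (1 - p) * h).
  by rewrite /= -/h; field; rewrite (gt_eqF c0).
by rewrite ler_pdivlMr //; nra.
Qed.

(** When the run goes down, its ray starts in a uniform child: the first step
    chooses the child, and if the frog comes back from it the run starts
    afresh. *)
Lemma loss_run_child n x' j Vis pos u a (b : 'I_d -> R) : u \in Vis ->
  pos u = j :: x' -> j :: x' \in Vis ->
  loss Vis (relocate pos u x') <= a ->
  (forall i z Vis', {subset Vis <= Vis'} -> ray n (i :: j :: x') Vis' ->
     loss Vis' (relocate pos u z) <= b i) ->
  loss Vis pos <= up_prob n.+1 * a + \sum_(i < d) (1 - up_prob n.+1) / d%:R * b i.
Proof.
have /andP[p0 p1] := p01.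
move=> uV pu xV la lb; set h := up_prob n; set l := loss Vis pos.
have /andP[h0 h1] : 0 <= h < 1 := up_prob_bound n.
have step : l <= p * a + \sum_(i < d) (1 - p) / d%:R * (h * l + (1 - h) * b i).
  apply: le_trans (loss_step pos uV) _; rewrite pu move_cons lerD //.
    rewrite ler_wpM2l ?(ltW p0) //; apply: le_trans la.
    by apply: loss_sub => v vV; rewrite inE vV orbT.
  apply: ler_sum => i _; rewrite ler_wpM2l ?divr_ge0 ?ler0n ?subr_ge0 ?(ltW p1) //.
  apply: (@loss_run n (j :: x') i _ _ u).
  - by rewrite inE uV orbT.
  - by rewrite relocate_at.
  - by rewrite inE eqxx.
  - rewrite relocate_twice -pu relocate_id; apply: loss_sub => v vV.
    by rewrite inE vV orbT.
  - move=> z Vis' sub r; rewrite relocate_twice; apply: (lb i) => // v vV.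
    by rewrite sub // inE vV orbT.
set B := \sum_(i < d) b i / d%:R.
have eB : \sum_(i < d) (1 - p) / d%:R * (h * l + (1 - h) * b i) =
    (1 - p) * h * l + (1 - p) * (1 - h) * B.
  have {1}-> : (1 - p) * h * l = \sum_(i < d) (1 - p) / d%:R * (h * l).
    by rewrite sumr_const card_ord -[RHS]mulr_natr; field.
  by rewrite mulr_sumr -big_split; apply: eq_bigr => i _ /=; ring.
have c0 : 0 < 1 - (1 - p) * h by nra.
have -> : up_prob n.+1 * a + \sum_(i < d) (1 - up_prob n.+1) / d%:R * b i =
   (p * a + (1 - p) * (1 - h) * B) / (1 - (1 - p) * h).
  rewrite (_ : \sum_(i < d) _ = (1 - up_prob n.+1) * B); last first.
    by rewrite mulr_sumr; apply: eq_bigr => i _; ring.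
  by rewrite /= -/h; field; rewrite (gt_eqF c0).
by rewrite ler_pdivlMr //; rewrite eB in step; nra.
Qed.

(** From the root a frog almost surely goes [n] generations down. *)
Lemma loss_run_root n Vis pos u b : [::] \in Vis -> u \in Vis -> pos u = [::] ->
  (forall i z Vis', {subset Vis <= Vis'} -> ray n [:: i] Vis' ->
     loss Vis' (relocate pos u z) <= b) ->
  loss Vis pos <= b.
Proof.
move=> rV uV pu lb; set h := up_prob n; set l := loss Vis pos.
have /andP[h0 h1] : 0 <= h < 1 := up_prob_bound n.
suff : l <= h * l + (1 - h) * b by nra.
apply: le_trans (loss_step pos uV) _.
rewrite -[leRHS](move_const (pos u)) pu !move_root; apply: ler_sum => i _.
rewrite ler_wpM2l ?invr_ge0 ?ler0n //; apply: (@loss_run n [::] i _ _ u).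
- by rewrite inE uV orbT.
- by rewrite relocate_at.
- by rewrite inE eqxx.
- rewrite relocate_twice -pu relocate_id; apply: loss_sub => v vV.
  by rewrite inE vV orbT.
- move=> z Vis' sub r; rewrite relocate_twice; apply: (lb i) => // v vV.
  by rewrite sub // inE vV orbT.
Qed.

End Game.

(** * The self-similar strategy *)

Section ReturnLaw.
Variables (R : realType) (h w : R).

(** The expectation of [g] at the number of frogs that leave the subtree of
    [y], when [k] frogs are waiting at [y], [u] have already left, and [m] of
    the four usable children of [y] are unused; [E] is the law of the number of
    frogs that come back from a new child.  Each waiting frog leaves with
    probability [h], enters a given unused child with probability [w], and is
    abandoned otherwise. *)
Fixpoint pending (E : (nat -> R) -> R) (g : nat -> R) (m : nat) : nat -> nat -> R :=
  if m is m'.+1 then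
    fix F (k u : nat) : R :=
      if k is k'.+1 then
        h * F k' u.+1 + m%:R * w * E (fun l => pending E g m' (k' + l)%N u)
        + (1 - h - m%:R * w) * F k' u
      else g u
  else
    fix F (k u : nat) : R :=
      if k is k'.+1 then h * F k' u.+1 + (1 - h) * F k' u else g u.

(** The first argument of [pending] is [l.+1] because the frog of [y] itself
    waits together with the [l] ones that come back from the child on the ray;
    that child being used, three are left. *)
Fixpoint returns (n : nat) (g : nat -> R) : R :=
  if n is n'.+1 then returns n' (fun l => pending (returns n') g 3 l.+1 0) else g 0%N.

Lemma pending0 E g m u : pending E g m 0 u = g u.
Proof. by case: m. Qed.

Lemma pendingS E g m k u : pending E g m k.+1 u =
  h * pending E g m k u.+1
  + (if m is m'.+1 then m%:R * w * E (fun l => pending E g m' (k + l)%N u) else 0)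
  + (1 - h - m%:R * w) * pending E g m k u.
Proof. by case: m => [|m] //=; rewrite mul0r subr0 addr0. Qed.

End ReturnLaw.

Section Subtree.
Variables (R : realType) (d : nat) (p : R) (K : nat) (h w : R) (N0 : nat).
Hypothesis d_ge4 : (4 <= d)%N.
Hypothesis p01 : 0 < p < 1.
Hypothesis w_ge0 : 0 <= w.
Hypothesis h_ge0 : 0 <= h.
Hypothesis h_le : forall n, (N0 <= n)%N -> h <= up_prob p n.
Hypothesis w_le : forall n, (N0 <= n)%N -> 4 * w <= 1 - up_prob p n.

Let d_gt0 : (0 < d)%N. Proof. exact: leq_trans d_ge4. Qed.

Lemma suffix_child (i : 'I_d) (y v : vertex d) : suffix (i :: y) v -> suffix y v.
Proof. exact/suffix_trans/suffix_cons. Qed.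

Lemma suffix_children (i j : 'I_d) (y v : vertex d) :
  suffix (i :: y) v -> suffix (j :: y) v -> i = j.
Proof.
by rewrite !suffixE => /eqP e1 /eqP e2; move: e1; rewrite e2 => -[].
Qed.

Lemma not_suffix_child (i : 'I_d) (y : vertex d) : suffix (i :: y) y = false.
Proof. by apply/negP => /size_suffix; rewrite /= ltnn. Qed.

Definition arrived (y x : vertex d) k (Vis : seq (vertex d)) pos :=
  exists s, [/\ uniq s, size s = k &
    forall u, u \in s -> [/\ suffix y u, u \in Vis & pos u = x]].

(** The induction hypothesis on the depth of the ray, in continuation passing
    style: [g] bounds the loss after the subtree of [j :: x] has been dealt with,
    whatever happened in it and to the abandoned frogs, in terms of the number
    of frogs that have come out of it.  The frogs of the subtree must be at
    home, but some of them may already be awake. *)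
Definition subtree_bound n := forall j x Vis pos g,
  ray n (j :: x) Vis ->
  (forall u, suffix (j :: x) u -> pos u = u) ->
  (forall k Vis' pos', {subset Vis <= Vis'} ->
     (forall u, ~~ suffix (j :: x) u -> pos' u = pos u) ->
     arrived (j :: x) x k Vis' pos' -> loss p K Vis' pos' <= g k) ->
  loss p K Vis pos <= returns h w n g.

(** Abandoning a frog is always possible, hence the [Num.min]: the favourable
    outcomes have at least the rates [h] and [m * w], and what exceeds these
    rates is counted as abandoned.  The inequality [4 <= d] gives
    [(d - #|J|) / d >= m / 4]. *)
Lemma run_outcomes_le q (a b c : R) m (J : {set 'I_d}) : (#|J| + m = 4)%N ->
  h <= q -> 4 * w <= 1 - q -> q <= 1 ->
  q * Num.min a c + \sum_(i < d) (1 - q) / d%:R * (if i \in J then c else Num.min b c)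
    <= h * a + m%:R * w * b + (1 - h - m%:R * w) * c.
Proof.
move=> cJ hq wq q1; set b' := Num.min b c; set a' := Num.min a c.
have [a'a a'c] : a' <= a /\ a' <= c by rewrite !ge_min !lexx orbT.
have [b'b b'c] : b' <= b /\ b' <= c by rewrite !ge_min !lexx orbT.
have dR : d%:R != 0 :> R by rewrite pnatr_eq0 -lt0n.
have -> : \sum_(i < d) (1 - q) / d%:R * (if i \in J then c else b') =
    (1 - q) * c - (1 - q) * (d%:R - #|J|%:R) / d%:R * (c - b').
  have eJ : \sum_(i < d) (i \in J)%:R = #|J|%:R :> R.
    rewrite -sum1_card natr_sum [in RHS]big_mkcond /=.
    by apply: eq_bigr => i _; case: (i \in J).
  rewrite (eq_bigr (fun i => (1 - q) / d%:R * b' +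
    (i \in J)%:R * ((1 - q) / d%:R * (c - b')))).
    rewrite big_split /= sumr_const card_ord -mulr_suml eJ -mulr_natr; field.
    by [].
  by move=> i _; case: (i \in J); rewrite /=; ring.
have m4 : (m <= 4)%N by rewrite -cJ leq_addl.
have frac : m%:R * w <= (1 - q) * (d%:R - #|J|%:R) / d%:R.
  rewrite -mulrA; apply: (@le_trans _ _ (4 * w * (m%:R / 4))); first by nra.
  apply: ler_pM => //; rewrite ?mulr_ge0 ?divr_ge0 ?ler0n //.
  have d0 : 0 < d%:R :> R by rewrite ltr0n.
  rewrite ler_pdivlMr // mulrAC ler_pdivrMr ?ltr0n //.
  have -> : #|J|%:R = 4 - m%:R :> R by rewrite -cJ natrD addrK.
  have : 4 <= d%:R :> R by rewrite (ler_nat R 4).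
  have : m%:R <= 4 :> R by rewrite (ler_nat R _ 4).
  by nra.
have m0 : 0 <= m%:R * w by rewrite mulr_ge0 ?ler0n.
move: frac; set X := (1 - q) * _ / _; set M := m%:R * w in m0 * => frac.
have up : q * (a' - c) <= h * (a - c).
  apply: (@le_trans _ _ (h * (a' - c))); first by rewrite ler_wnM2r ?subr_le0.
  by rewrite ler_wpM2l // lerB.
have new : X * (b' - c) <= M * (b - c).
  apply: (@le_trans _ _ (M * (b' - c))); first by rewrite ler_wnM2r ?subr_le0.
  by rewrite ler_wpM2l // lerB.
by lra.
Qed.

Section Pending.
Variables (n : nat) (j : 'I_d) (x : vertex d).
Variables (Vis0 : seq (vertex d)) (pos0 : vertex d -> vertex d) (g : nat -> R).
Let y := j :: x.
Hypothesis IH : subtree_bound n.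
Hypothesis y_vis : y \in Vis0.
Hypothesis gP : forall k Vis' pos', {subset Vis0 <= Vis'} ->
     (forall u, ~~ suffix y u -> pos' u = pos0 u) ->
     arrived y x k Vis' pos' -> loss p K Vis' pos' <= g k.

(** [J] is the set of used children, [s] lists the frogs that wait at [y] and
    [t] those that have left.  Frogs that were abandoned stand anywhere; they
    come from none of the untouched subtrees since these frogs are at home. *)
Definition pending_bound m := forall (J : {set 'I_d}) Vis pos s t,
  (#|J| + m = 4)%N -> {subset Vis0 <= Vis} ->
  (forall i u, i \notin J -> suffix (i :: y) u -> pos u = u) ->
  (forall u, ~~ suffix y u -> pos u = pos0 u) ->
  uniq s -> (forall u, u \in s -> [/\ suffix y u, u \in Vis & pos u = y]) ->
  uniq t -> (forall u, u \in t -> [/\ suffix y u, u \in Vis & pos u = x]) ->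
  loss p K Vis pos <= pending h w (returns h w n) g m (size s) (size t).

Lemma pending_bound_step m :
  (forall m', m = m'.+1 -> pending_bound m') -> pending_bound m.
Proof.
move=> IHm J Vis pos s t cJ.
have yx : (y == x) = false by rewrite childNparent.
elim: s Vis pos t => [|v s IHs] Vis pos t sub fresh out us sP ut tP.
  by rewrite pending0; apply: gP => //; exists t.
case/andP: us => vs us; have [yv vV pv] := sP v (mem_head _ _).
have vt : v \notin t.
  by apply/negP => /tP[_ _]; rewrite pv => e; move: yx; rewrite e eqxx.
(* wherever [v] goes, the rest of the position is as required *)
have moved_fresh z i u : i \notin J -> suffix (i :: y) u -> relocate pos v z u = u.
  move=> iJ iu; rewrite relocate_other; first exact: fresh iu.
  apply/eqP => uv; move: (fresh i v iJ); rewrite -uv iu uv pv => /(_ isT) vy.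
  by move: iu; rewrite uv -vy not_suffix_child.
have moved_out z u : ~~ suffix y u -> relocate pos v z u = pos0 u.
  by move=> yu; rewrite relocate_other ?out //; apply: contraNneq yu => ->.
have moved_s z (Vis' : seq (vertex d)) : {subset Vis <= Vis'} -> forall u, u \in s ->
    [/\ suffix y u, u \in Vis' & relocate pos v z u = y].
  move=> sub' u us'; have [yu uV pu] : [/\ suffix y u, u \in Vis & pos u = y].
    by apply: sP; rewrite inE us' orbT.
  by split; rewrite ?sub' // relocate_other //; apply: contraNneq vs => <-.
have moved_t z (Vis' : seq (vertex d)) : {subset Vis <= Vis'} -> forall u, u \in t ->
    [/\ suffix y u, u \in Vis' & relocate pos v z u = x].
  move=> sub' u ut'; have [yu uV pu] := tP u ut'.
  by split; rewrite ?sub' // relocate_other //; apply: contraNneq vt => <-.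
have drop z Vis' : {subset Vis <= Vis'} -> loss p K Vis' (relocate pos v z) <=
    pending h w (returns h w n) g m (size s) (size t).
  move=> sub'; apply: IHs => //; first by move=> u /sub /sub'.
  - exact: moved_fresh.
  - exact: moved_out.
  - exact: moved_s.
  - exact: moved_t.
have up : loss p K Vis (relocate pos v x) <=
    pending h w (returns h w n) g m (size s) (size t).+1.
  apply: (IHs _ _ (v :: t)) => //.
  - exact: moved_fresh.
  - exact: moved_out.
  - exact: moved_s.
  - by rewrite /= vt.
  - move=> u; rewrite inE => /orP[/eqP->|]; first by rewrite relocate_at.
    exact: moved_t.
(* the run is long enough to leave a ray of length [n] and for the rates *)
pose N := maxn n N0.
have hN := h_le (leqW (leq_maxr n N0)).
have wN := w_le (leqW (leq_maxr n N0)).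
have /andP[_ /ltW N1] := up_prob_bound p01 N.+1.
pose b := if m is m'.+1 then
  returns h w n (fun l => pending h w (returns h w n) g m' (size s + l)%N (size t))
  else pending h w (returns h w n) g m (size s) (size t).
have new i z Vis' : i \notin J -> {subset Vis <= Vis'} -> ray N (i :: y) Vis' ->
    loss p K Vis' (relocate pos v z) <= b.
  move=> iJ sub' r; rewrite /b.
  case: m IHm cJ {IHs up b} drop => [|m'] IHm cJ drop; first exact: drop.
  apply: IH; first by apply: ray_le r; exact: leq_maxl.
    by move=> u; exact: moved_fresh.
  move=> l Vis'' pos'' sub'' out'' [s2 [us2 <- s2P]].
  have outside z' u : relocate pos v z u = z' -> (size z' <= size y)%N ->
      ~~ suffix (i :: y) u.
    move=> e sz; apply/negP => iu; move: (moved_fresh z i u iJ iu).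
    by rewrite e => uz; move: (size_suffix iu); rewrite -uz /= ltnNge sz.
  rewrite -size_cat; apply: (IHm m' erefl (i |: J)) => //.
  - by rewrite cardsU1 iJ -cJ add1n addSn addnS.
  - by move=> u /sub /sub' /sub''.
  - move=> i' u; rewrite in_setU1 negb_or => /andP[i'i i'J] i'u.
    rewrite out''; first exact: moved_fresh i'u.
    by apply: contraNN i'i => iu; rewrite (suffix_children i'u iu).
  - move=> u yu; rewrite out'' ?moved_out //.
    by apply: contraNN yu; exact: suffix_child.
  - rewrite cat_uniq; apply/and3P; split => //; apply/hasPn => u /s2P[iu _ _].
    apply: contraL iu => us'; have [_ _ pu] := moved_s z _ sub' u us'.
    exact: (outside _ _ pu (leqnn _)).
  - move=> u; rewrite mem_cat => /orP[us'|/s2P[iu uV pu]].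
      have [yu uV pu] := moved_s z _ sub' u us'.
      by rewrite yu sub'' // out'' ?(outside _ _ pu).
    by rewrite (suffix_child iu) uV pu.
  - move=> u ut'; have [yu uV pu] := moved_t z _ sub' u ut'.
    by rewrite yu sub'' // out'' ?(outside _ _ pu).
rewrite pendingS.
set c := pending _ _ _ _ m (size s) (size t).
set a := pending _ _ _ _ m (size s) (size t).+1.
apply: le_trans (_ : _ <= h * a + m%:R * w * b + (1 - h - m%:R * w) * c) _; last first.
  by rewrite /b; case: (m) => [|m'] //; rewrite mul0r mul0r.
apply: le_trans (run_outcomes_le a b c cJ hN wN N1).
apply: (loss_run_child d_gt0 p01 vV pv).
- by apply: sub.
- by rewrite le_min up drop.
- move=> i z Vis' sub' r; case: ifPn => iJ; first exact: drop.
  by rewrite le_min (new i) ?drop.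
Qed.

Lemma loss_le_pending m : pending_bound m.
Proof. by elim: m => [|m IHm]; apply: pending_bound_step => // m' [<-]. Qed.

End Pending.

Lemma subtree_boundP n : subtree_bound n.
Proof.
elim: n => [|n IHn] j x Vis pos g r fresh gP.
  apply: gP => //=; exists [::]; split => //.
move: (r) => /= [yV [i ri]].
apply: (IHn i (j :: x)) => //.
  by move=> u iu; apply: fresh; exact: suffix_child iu.
move=> l Vis' pos' sub out [s [us <- sP]].
have y_out : ~~ suffix (i :: j :: x) (j :: x) by rewrite not_suffix_child.
have bound := @loss_le_pending n j x Vis pos g IHn yV gP 3 [set i]%SET Vis' pos'
  ((j :: x) :: s) [::].
apply: bound.
- by rewrite cards1.
- exact: sub.
- move=> i' u; rewrite inE => i'i iu.
  rewrite out; first by apply: fresh; exact: suffix_child iu.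
  by apply: contraNN i'i => iu'; rewrite (suffix_children iu iu').
- by move=> u yu; apply: out; apply: contraNN yu; exact: suffix_child.
- by rewrite /= us andbT; apply: contraNN y_out => /sP[].
- move=> u; rewrite inE => /orP[/eqP->|/sP[iu uV pu]]; last first.
    by split => //; exact: suffix_child iu.
  by rewrite suffix_refl sub // out // fresh ?suffix_refl.
- by [].
- by [].
Qed.

(** The frog of the root goes down, and leaves a ray in the subtree of a child
    of the root. *)
Lemma loss_le_returns n :
  loss p K [:: [::] : vertex d] id <= returns h w n (fun k => (k < K)%:R).
Proof.
apply: (loss_run_root (n := n) (u := [::]) d_gt0 p01) => // i z Vis sub r.
apply: subtree_boundP r _ _.
  by move=> u iu; rewrite relocate_other //; apply: contraTneq iu => ->.
move=> k Vis' pos' sub' out [s [us <- sP]].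
apply: le_trans (loss_stop_le d_gt0 p01 _ _ _) _; rewrite ler_nat.
have : (size s <= returned Vis' pos')%N.
  rewrite /returned -size_filter; apply: uniq_leq_size => // u /sP[iu uV pu].
  rewrite mem_filter mem_undup uV pu eqxx !andbT.
  by apply: contraTneq iu => ->.
case: (ltnP (size s) K) => [_ _|le1 le2]; first exact: leq_b1.
by rewrite ltnNge (leq_trans le1 le2).
Qed.

End Subtree.

(** * The generating function of the number of returns *)

Section Expectation.
Variable R : realType.
Implicit Types (E : (nat -> R) -> R) (f g : nat -> R).

Definition expectation E :=
  [/\ forall a b f g, E (fun k => a * f k + b * g k) = a * E f + b * E g,
      forall f g, (forall k, f k <= g k) -> E f <= E g
    & E (fun=> 1) = 1].

Lemma expectation_scale E a f : expectation E -> E (fun k => a * f k) = a * E f.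
Proof.
case=> lin _ _; have := lin a 0 f f; rewrite mul0r addr0 => <-.
by congr E; apply/funext => k; rewrite mul0r addr0.
Qed.

Lemma expectation_cst E a : expectation E -> E (fun=> a) = a.
Proof.
move=> eE; have [_ _ E1] := eE; rewrite -[RHS]mulr1 -E1 -expectation_scale //.
by congr E; apply/funext => k; rewrite mulr1.
Qed.

Lemma expectation_sum E n (c : nat -> R) (f : nat -> nat -> R) : expectation E ->
  E (fun k => \sum_(i < n) c i * f i k) = \sum_(i < n) c i * E (f i).
Proof.
move=> eE; elim: n => [|n IH].
  rewrite big_ord0 -[RHS](expectation_cst 0 eE); congr E.
  by apply/funext => k; rewrite big_ord0.
have [lin _ _] := eE; rewrite big_ord_recr /= -IH.
have := lin 1 (c n) (fun k => \sum_(i < n) c i * f i k) (f n); rewrite mul1r => <-.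
by congr E; apply/funext => k; rewrite mul1r big_ord_recr.
Qed.

Lemma weighted_agm (u v : R) (r s : nat) :
  (0 < s <= r)%N -> 0 <= u -> 0 <= v ->
  u ^+ s * v ^+ (r - s) <= (s%:R / r%:R * u + (1 - s%:R / r%:R) * v) ^+ r.
Proof.
move=> /andP[s0 sr] u0 v0.
have [//|+ _] := @leif_AGM R 'I_r predT (fun i => if (i < s)%N then u else v).
  by move=> i _; case: ifP.
rewrite card_ord.
have split_at (T : Type) (idx : T) (op : Monoid.com_law idx) (a b : T) :
    \big[op/idx]_(i < r) (if (i < s)%N then a else b) =
    op (\big[op/idx]_(i < s) a) (\big[op/idx]_(i < r - s) b).
  rewrite -(big_mkord predT (fun i => if (i < s)%N then a else b)).
  rewrite (@big_cat_nat _ _ _ s) //=; congr (op _ _).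
    by rewrite big_mkord; apply: eq_bigr => i _; rewrite ltn_ord.
  rewrite -{1}[s]add0n big_addn big_mkord; apply: eq_bigr => i _.
  by rewrite ltnNge leq_addl.
rewrite !split_at !prodr_const !sumr_const !card_ord => /le_trans; apply.
rewrite le_eqVlt; apply/orP; left; apply/eqP; congr (_ ^+ _).
have r0 : r%:R != 0 :> R by rewrite pnatr_eq0 -lt0n (leq_trans s0).
by rewrite /= -(mulr_natr u) -(mulr_natr v) natrB //; field.
Qed.

(** Jensen's inequality for the concave function [y ^ (s / r)], written without
    real exponents: the function is bounded by its tangent at [S ^ r], and this
    bound is the inequality between the weighted means. *)
Lemma expectation_jensen E (th x S : R) (r s : nat) : expectation E ->
  (0 < s <= r)%N -> 0 <= th -> 0 <= x -> 0 < S -> th ^+ r <= x ^+ s ->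
  E (fun k => x ^+ k) <= S ^+ r -> E (fun k => th ^+ k) <= S ^+ s.
Proof.
move=> eE sr' th0 x0 S0 thx Ex; have [_ mono _] := eE; have /andP[s0 sr] := sr'.
have r0 : 0 < r%:R :> R by rewrite ltr0n (leq_trans s0).
pose a : R := s%:R / r%:R; pose c := S ^+ s / S ^+ r.
have a01 : 0 <= a <= 1.
  by rewrite /a divr_ge0 ?ler0n //= ler_pdivrMr // mul1r ler_nat.
have [a0 a1] := andP a01.
have c0 : 0 <= c by rewrite divr_ge0 ?exprn_ge0 ?(ltW S0).
have step k : th ^+ k <= a * c * x ^+ k + (1 - a) * S ^+ s.
  have c1 : c ^+ s * (S ^+ s) ^+ (r - s) = 1.
    rewrite /c expr_div_n -!exprM mulrAC -exprD -mulnDr subnKC // (mulnC r).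
    by rewrite divff // expf_neq0 // gt_eqF.
  rewrite -mulrA -(@ler_pXn2r _ r) ?nnegrE ?exprn_ge0 ?(leq_trans s0) //; last first.
    by apply: addr_ge0; apply: mulr_ge0 => //; [exact: mulr_ge0 c0 (exprn_ge0 _ x0)
      |rewrite subr_ge0|exact: exprn_ge0 (ltW S0)].
  apply: le_trans (weighted_agm sr' (mulr_ge0 c0 (exprn_ge0 k x0))
    (exprn_ge0 s (ltW S0))).
  rewrite exprMn mulrAC c1 mul1r -!exprM mulnC (mulnC k) !exprM.
  by rewrite lerXn2r ?nnegrE ?exprn_ge0.
apply: le_trans (mono _ _ step) _.
have [lin _ E1] := eE.
have -> : E (fun k => a * c * x ^+ k + (1 - a) * S ^+ s) =
    a * c * E (fun k => x ^+ k) + (1 - a) * S ^+ s.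
  have := lin (a * c) ((1 - a) * S ^+ s) (fun k => x ^+ k) (fun=> 1).
  by rewrite E1 mulr1 => <-.
have Sr : S ^+ r != 0 by rewrite expf_neq0 // gt_eqF.
have : a * c * E (fun k => x ^+ k) <= a * S ^+ s.
  apply: le_trans (_ : _ <= a * c * S ^+ r) _.
    by rewrite ler_wpM2l // mulr_ge0 //; case/andP: a01.
  by rewrite -mulrA /c divfK.
lra.
Qed.
End Expectation.

Section ReturnExpectation.
Variables (R : realType) (h w : R).
Hypothesis hw0 : 0 <= h /\ 0 <= w.
Hypothesis hw1 : h + 3 * w <= 1.

Let weight_ge0 m : (m <= 3)%N -> 0 <= m%:R * w /\ 0 <= 1 - h - m%:R * w.
Proof.
move=> m3; have m3' : m%:R <= 3 :> R by rewrite ler_nat.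
have [h0 w0] := hw0; split; first by rewrite mulr_ge0.
have : m%:R * w <= 3 * w by rewrite ler_wpM2r.
by move: hw1; lra.
Qed.

Lemma pending_expectation E m k u : expectation E -> (m <= 3)%N ->
  expectation (fun g => pending h w E g m k u).
Proof.
move=> eE; have [lin mono _] := eE; have [h0 w0] := hw0.
elim: m k u => [|m IHm] k u m3; elim: k u => [|k IHk] u;
  have [mw0 c0] := weight_ge0 m3.
- by split=> *; rewrite !pending0.
- have [lin1 mono1 E1] := IHk u; have [lin2 mono2 E2] := IHk u.+1.
  split=> *; rewrite !pendingS.
  + by rewrite lin1 lin2; ring.
  + by rewrite !addr0 lerD ?ler_wpM2l ?mono1 ?mono2.
  + by rewrite E1 E2; ring.
- by split=> *; rewrite !pending0.
- have [lin1 mono1 E1] := IHk u; have [lin2 mono2 E2] := IHk u.+1.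
  have IH l := IHm (k + l)%N u (ltnW m3).
  split=> [a b f g|f g fg|]; rewrite !pendingS.
  + rewrite lin1 lin2.
    rewrite (_ : (fun l => pending h w E _ m (k + l)%N u) =
       fun l => a * pending h w E f m (k + l)%N u + b * pending h w E g m (k + l)%N u).
      by rewrite lin; ring.
    by apply/funext => l; have [linm _ _] := IH l; rewrite linm.
  + rewrite !lerD ?ler_wpM2l ?mono1 ?mono2 //; apply: mono => l.
    by have [_ monom _] := IH l; exact: monom.
  + rewrite E1 E2 (_ : (fun l => _) = fun=> 1); last first.
      by apply/funext => l; have [_ _ ->] := IH l.
    by have [_ _ ->] := eE; ring.
Qed.

Lemma returns_expectation n : expectation (returns h w n).
Proof.
elim: n => [|n IH] /=; first by split.
have P l : expectation (fun g => pending h w (returns h w n) g 3 l.+1 0).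
  exact: pending_expectation.
have [lin mono E1] := IH; split=> [a b f g|f g fg|].
- rewrite -lin; congr (returns h w n); apply/funext => l.
  by have [linP _ _] := P l; exact: linP.
- by apply: mono => l; have [_ + _] := P l; apply.
- rewrite -[RHS]E1; congr (returns h w n); apply/funext => l.
  by have [_ _ P1] := P l; exact: P1.
Qed.

Variable x : R.
Hypothesis x01 : 0 <= x <= 1.

(** The probability that a waiting frog opens no new child and, if it leaves,
    is not marked, when [i] children are unused and frogs that leave are marked
    with probability [1 - x]. *)
Definition theta (i : nat) : R := 1 - h * (1 - x) - i%:R * w.

(** As a function of the number [k] of waiting frogs, the generating function of
    the number of frogs that leave is a combination of the powers
    [theta i ^+ k].  When [F i] is the generating function of the returns at
    [theta i], the coefficient [coef F m i] is the probability that exactly [i]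
    of the [m] unused children are such that opening them would bring about a
    marked frog.  The recursion identifies the coefficients of [theta i ^+ k] in
    the equation that defines [pending]; the last coefficient is fixed by the
    value at [k = 0]. *)
Fixpoint coef (F : nat -> R) (m i : nat) : R :=
  if m is m'.+1 then
    if i == m then 1 - \sum_(j < m) m%:R / (m - j)%:R * coef F m' j * F j
    else m%:R / (m - i)%:R * coef F m' i * F i
  else 1.

Lemma coef_last F m : coef F m.+1 m.+1 =
  1 - \sum_(j < m.+1) coef F m.+1 j.
Proof.
rewrite /= eqxx; congr (_ - _); apply: eq_bigr => j _.
by rewrite ltn_eqF.
Qed.

Lemma theta_ge0 i : (i <= 3)%N -> 0 <= theta i.
Proof.
move=> i3; have [h0 w0] := hw0; have [_ +] := weight_ge0 i3.
by rewrite /theta; case/andP: x01; nra.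
Qed.

(** The bounds [F i] may replace the exact values of the generating function
    because the coefficients are nonnegative. *)
Lemma pending_le E F m k u : expectation E -> (m <= 3)%N ->
  (forall i, (i <= 3)%N -> E (fun l => theta i ^+ l) <= F i) ->
  (forall m' i, (i <= m')%N -> (m' < m)%N -> 0 <= coef F m' i) ->
  pending h w E (fun v => x ^+ v) m k u <=
    x ^+ u * \sum_(i < m.+1) coef F m i * theta i ^+ k.
Proof.
move=> eE + FP; have [h0 w0] := hw0; have /andP[x0 _] := x01.
elim: m k u => [|m IHm] k u m3 cF; elim: k u => [|k IHk] u;
  have [mw0 c0] := weight_ge0 m3.
- by rewrite pending0 big_ord_recr big_ord0 /= expr0 add0r !mulr1.
- have one q : \sum_(i < 1) coef F 0 i * theta i ^+ q = theta 0 ^+ q.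
    by rewrite big_ord_recr big_ord0 /= add0r mul1r.
  rewrite pendingS addr0; move: (IHk u) (IHk u.+1); rewrite !one => H1 H2.
  apply: le_trans (_ : h * (x ^+ u.+1 * theta 0 ^+ k) +
      (1 - h - 0%:R * w) * (x ^+ u * theta 0 ^+ k) <= _).
    by rewrite lerD // ler_wpM2l.
  by rewrite le_eqVlt; apply/orP; left; apply/eqP; rewrite !exprS /theta; ring.
- rewrite pending0 (eq_bigr (fun i : 'I_m.+2 => coef F m.+1 i)); last first.
    by move=> i _; rewrite expr0 mulr1.
  by rewrite big_ord_recr [X in _ * (_ + X)]coef_last addrCA subrr addr0 mulr1.
- rewrite pendingS.
  have mF : E (fun l => pending h w E (fun v => x ^+ v) m (k + l)%N u) <=
      x ^+ u * \sum_(i < m.+1) coef F m i * theta i ^+ k * F i.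
    have [_ mono _] := eE.
    have cF' m' i : (i <= m')%N -> (m' < m)%N -> 0 <= coef F m' i.
      by move=> im' /leqW; exact: cF.
    apply: le_trans (mono _ _ (fun l => IHm (k + l)%N u (ltnW m3) cF')) _.
    rewrite expectation_scale // ler_wpM2l ?exprn_ge0 //.
    rewrite (_ : (fun l => _) = fun l =>
      \sum_(i < m.+1) (coef F m i * theta i ^+ k) * theta i ^+ l); last first.
      by apply/funext => l; apply: eq_bigr => i _; rewrite exprD mulrA.
    rewrite (expectation_sum m.+1 (fun i => coef F m i * theta i ^+ k)
      (fun i l => theta i ^+ l) eE); apply: ler_sum => i _; have im := ltn_ord i.
    have i3 : (i <= 3)%N by rewrite (leq_trans (ltnW im)).
    by rewrite ler_wpM2l ?FP // mulr_ge0 ?cF ?exprn_ge0 ?theta_ge0.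
  set S := \sum_(i < m.+2) coef F m.+1 i * theta i ^+ k.
  set S' := \sum_(i < m.+1) _ in mF.
  apply: le_trans (_ : h * (x ^+ u.+1 * S) + m.+1%:R * w * (x ^+ u * S') +
      (1 - h - m.+1%:R * w) * (x ^+ u * S) <= _).
    by rewrite !lerD // ler_wpM2l.
  rewrite le_eqVlt; apply/orP; left; apply/eqP.
  transitivity (x ^+ u * (theta m.+1 * S + m.+1%:R * w * S')).
    by rewrite exprS /theta; ring.
  congr (_ * _); rewrite /S /S' [X in _ * X + _]big_ord_recr [RHS]big_ord_recr.
  rewrite [X in X + _]mulrDr [X in _ + X + _]mulrCA -exprS addrAC; congr (_ + _).
  rewrite !mulr_sumr -big_split; apply: eq_bigr => i _ /=; have im := ltn_ord i.
  rewrite ltn_eqF // natrB ?(ltnW im) // exprS /theta.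
  have d0 : m.+1%:R - i%:R != 0 :> R by rewrite subr_eq0 eqr_nat gtn_eqF.
  by move: d0; move: (m.+1%:R : R) (i%:R : R) => M I d0; field.
Qed.

Lemma returns_step n F :
  (forall i, (i <= 3)%N -> returns h w n (fun l => theta i ^+ l) <= F i) ->
  (forall m i, (i <= m)%N -> (m <= 3)%N -> 0 <= coef F m i) ->
  returns h w n.+1 (fun k => x ^+ k) <= \sum_(i < 4) coef F 3 i * theta i * F i.
Proof.
move=> FP cF; have eE := returns_expectation n; have [_ mono _] := eE.
have cF' m i : (i <= m)%N -> (m < 3)%N -> 0 <= coef F m i.
  by move=> im m3; rewrite cF // ltnW.
apply: le_trans (mono _ _ (fun l => pending_le l.+1 0 eE (leqnn 3) FP cF')) _.
rewrite (_ : (fun l => _) = fun l =>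
  \sum_(i < 4) (coef F 3 i * theta i) * theta i ^+ l); last first.
  by apply/funext => l; rewrite mul1r; apply: eq_bigr => i _; rewrite exprS mulrA.
rewrite (expectation_sum 4 (fun i => coef F 3 i * theta i)
  (fun i l => theta i ^+ l) eE); apply: ler_sum => i _.
have i3 : (i <= 3)%N by rewrite -ltnS.
by rewrite ler_wpM2l ?FP // mulr_ge0 ?cF ?theta_ge0.
Qed.

End ReturnExpectation.

(** * Nonnegative polynomials on an interval *)

Delimit Scope Z_scope with binZ.

Section Homogeneous.
Variable R : realType.

Definition ZR (z : Z) : R := (int_of_Z z)%:~R.

Lemma ZR_add a b : ZR (BinInt.Z.add a b) = ZR a + ZR b.
Proof. by rewrite /ZR -intrD -[in RHS]raddfD. Qed.

Lemma ZR_mul a b : ZR (BinInt.Z.mul a b) = ZR a * ZR b.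
Proof. by rewrite /ZR -intrM -[in RHS]rmorphM. Qed.

Lemma ZR_ge0 a : BinInt.Z.leb 0 a -> 0 <= ZR a.
Proof. by case: a => [|a|a] // _; rewrite /ZR ler0z. Qed.

(** The binary form with coefficients [l], homogeneous of degree
    [(size l).-1]. *)
Fixpoint form (l : seq Z) (s r : R) : R :=
  if l is a :: l' then ZR a * r ^+ size l' + s * form l' s r else 0.

Fixpoint form_add (l l' : seq Z) : seq Z :=
  match l, l' with
  | a :: l, b :: l' => BinInt.Z.add a b :: form_add l l'
  | _, _ => [::]
  end.

(** The coefficients of [(s + c * r) ^ n]. *)
Fixpoint line_pow (c : Z) (n : nat) : seq Z :=
  if n is n'.+1 then
    let q := line_pow c n' in
    form_add (rcons (map (BinInt.Z.mul c) q) 0%binZ) (0%binZ :: q)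
  else [:: 1%binZ].

(** The coefficients of the pullback of a form by [(s, r) |-> (s, s + c * r)]. *)
Fixpoint shear (c : Z) (l : seq Z) : seq Z :=
  if l is a :: l' then
    form_add (map (BinInt.Z.mul a) (line_pow c (size l'))) (0%binZ :: shear c l')
  else [::].

(** A form is nonnegative on the positive quadrant if its coefficients are, or
    if it is on both halves [s <= r] and [r <= s]; a shear maps the quadrant
    onto the first half, and reversing the coefficients swaps the two. *)
Fixpoint nonneg (n : nat) (l : seq Z) : bool :=
  all (BinInt.Z.leb 0) l ||
  if n is n'.+1 then nonneg n' (shear 2 l) && nonneg n' (shear 2 (rev l))
  else false.

Lemma size_form_add l l' : size l = size l' -> size (form_add l l') = size l.
Proof. by elim: l l' => [|a l IH] [|b l'] //= [/IH ->]. Qed.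

Lemma form_addE l l' s r : size l = size l' ->
  form (form_add l l') s r = form l s r + form l' s r.
Proof.
elim: l l' => [|a l IH] [|b l'] //=; first by rewrite addr0.
by case=> e; rewrite IH // size_form_add // ZR_add e; ring.
Qed.

Lemma form_scale a l s r : form (map (BinInt.Z.mul a) l) s r = ZR a * form l s r.
Proof.
elim: l => [|b l IH] /=; first by rewrite mulr0.
by rewrite IH size_map ZR_mul; ring.
Qed.

Lemma form_rcons l a s r : form (rcons l a) s r = r * form l s r + ZR a * s ^+ size l.
Proof.
elim: l => [|b l IH] /=; first by rewrite !mulr0 addr0 add0r.
by rewrite IH size_rcons !exprS; ring.
Qed.

Lemma ZR0 : ZR 0 = 0. Proof. by []. Qed.
Lemma ZR1 : ZR 1 = 1. Proof. by []. Qed.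

Lemma ZRp q : ZR (Zpos q) = (BinPos.Pos.to_nat q)%:R. Proof. by []. Qed.

Lemma ZRn q : ZR (Zneg q) = - (BinPos.Pos.to_nat q)%:R.
Proof. by rewrite -ZRp /ZR -intrN -[in RHS]raddfN. Qed.

Lemma size_line_pow c n : size (line_pow c n) = n.+1.
Proof. by elim: n => //= n IH; rewrite size_form_add /= ?size_rcons size_map IH. Qed.

Lemma form_line_pow c n s r : form (line_pow c n) s r = (s + ZR c * r) ^+ n.
Proof.
elim: n => [|n IH] /=; first by rewrite expr0 !mulr0 addr0 mulr1 ZR1.
rewrite form_addE /=; last by rewrite size_rcons size_map.
by rewrite form_rcons form_scale IH ZR0 exprS; ring.
Qed.

Lemma size_shear c l : size (shear c l) = size l.
Proof.
by elim: l => //= a l IH; rewrite size_form_add /= size_map size_line_pow ?IH.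
Qed.

Lemma form_shear c l s r : form (shear c l) s r = form l s (s + ZR c * r).
Proof.
elim: l => //= a l IH; rewrite form_addE /=; last first.
  by rewrite size_map size_line_pow size_shear.
by rewrite form_scale form_line_pow IH ZR0 mul0r add0r.
Qed.

Lemma form_rev l s r : form (rev l) s r = form l r s.
Proof.
elim: l => //= a l IH; rewrite rev_cons form_rcons IH size_rev; ring.
Qed.

Lemma form_dilate l s r c : form l (c * s) (c * r) * c = c ^+ size l * form l s r.
Proof.
elim: l => [|a l IH] /=; first by rewrite mulr0 mul0r.
rewrite exprS mulrDr -[c ^+ _ in RHS]/(c ^+ size l).
rewrite [(c * r) ^+ _]exprMn mulrDl.
have -> : c * s * form l (c * s) (c * r) * c = c * s * (c ^+ size l * form l s r).
  by rewrite -IH; ring.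
ring.
Qed.

Lemma nonneg_form n l s r : nonneg n l -> 0 <= s -> 0 <= r -> 0 <= form l s r.
Proof.
have pos l' s' r' :
    all (BinInt.Z.leb 0) l' -> 0 <= s' -> 0 <= r' -> 0 <= form l' s' r'.
  move=> + s0 r0; elim: l' => //= a l' IHl /andP[/ZR_ge0 a0 /IHl l0].
  by rewrite addr_ge0 ?mulr_ge0 ?exprn_ge0.
elim: n l s r => [|n IH] l s r /=; first by rewrite orbF; exact: pos.
case/orP => [l0 /pos|/andP[nl nr] s0 r0]; first exact.
have half l' s' r' : nonneg n (shear 2 l') -> 0 <= s' -> s' <= r' -> 0 <= form l' s' r'.
  move=> nl' s'0 sr.
  (* on s' <= r' the form is a positive multiple of its pullback by the shear *)
  have := IH _ (2 * s') (r' - s') nl' (mulr_ge0 (ler0n _ 2) s'0).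
  rewrite subr_ge0 => /(_ sr); rewrite form_shear.
  have -> : 2 * s' + ZR 2 * (r' - s') = 2 * r' by rewrite (_ : ZR 2 = 2) //; ring.
  move=> form0; have := mulr_ge0 form0 (ler0n R 2).
  by rewrite form_dilate pmulr_rge0 // exprn_gt0.
case: (leP s r) => [|/ltW] sr; first exact: half.
by rewrite -form_rev half.
Qed.

End Homogeneous.

(** * The number of returns tends to infinity *)

Section Numerics.
Variable R : realType.

Lemma coef_values (F : nat -> R) :
  let c22 := (1 - F 0%N) * (1 + F 0%N - 2 * F 1%N) in
  [/\ coef F 1 0 = F 0%N, coef F 1 1 = 1 - F 0%N,
      [/\ coef F 2 0 = F 0%N ^+ 2, coef F 2 1 = 2 * (1 - F 0%N) * F 1%N &
          coef F 2 2 = c22]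
    & [/\ coef F 3 0 = F 0%N ^+ 3, coef F 3 1 = 3 * (1 - F 0%N) * F 1%N ^+ 2,
          coef F 3 2 = 3 * c22 * F 2%N
        & coef F 3 3 = 1 - F 0%N ^+ 3 - 3 * (1 - F 0%N) * F 1%N ^+ 2
                       - 3 * c22 * F 2%N]].
Proof.
rewrite /=; do 4!(rewrite ?big_ord_recr ?big_ord0 /=).
rewrite !subSS !subn0.
by split; [field|field|split; field|split; field].
Qed.

Local Arguments coef : simpl never.

(** At [c = b] the expression is
    [(1 - a) * ((1 - a) ^ 2 + 3 * (a - b) * (1 - b))]. *)
Lemma coef_last_ge0 (a b c : R) : 0 <= b -> b <= a -> a <= 1 -> c <= b ->
  0 <= 1 - a ^+ 3 - 3 * (1 - a) * b ^+ 2 - 3 * ((1 - a) * (1 + a - 2 * b)) * c.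
Proof.
move=> b0 ba a1 cb.
have sq : 0 <= (1 - a) * ((1 - a) ^+ 2 + 3 * (a - b) * (1 - b)).
  apply: mulr_ge0; first by lra.
  by apply: addr_ge0; [exact: sqr_ge0|apply: mulr_ge0; [apply: mulr_ge0|]]; lra.
have le : (1 - a) * (1 + a - 2 * b) * c <= (1 - a) * (1 + a - 2 * b) * b.
  by rewrite ler_wpM2l // mulr_ge0; lra.
by lra.
Qed.

Lemma coef_ge0 (F : nat -> R) m i : 0 <= F 3%N -> F 3%N <= F 2%N ->
  F 2%N <= F 1%N -> F 1%N <= F 0%N ->
  F 0%N <= 1 -> (i <= m)%N -> (m <= 3)%N -> 0 <= coef F m i.
Proof.
have [v10 v11 [v20 v21 v22] [v30 v31 v32 v33]] := coef_values F.
move=> F3 F32 F21 F10 F0.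
have F2 : 0 <= F 2%N by lra. have F1 : 0 <= F 1%N by lra.
have F0' : 0 <= F 0%N by lra.
have c22 : 0 <= (1 - F 0%N) * (1 + F 0%N - 2 * F 1%N) by rewrite mulr_ge0 //; lra.
case: m => [|[|[|[|//]]]] im _ //.
- by case: i im => [|[|//]] _; rewrite ?v10 ?v11 //; lra.
- case: i im => [|[|[|//]]] _; rewrite ?v20 ?v21 ?v22 ?exprn_ge0 //.
  by rewrite !mulr_ge0 //; lra.
- case: i im => [|[|[|[|//]]]] _; rewrite ?v30 ?v31 ?v32 ?exprn_ge0 //.
  + by rewrite !mulr_ge0 ?exprn_ge0 //; lra.
  + by rewrite !mulr_ge0 //; lra.
  + by rewrite v33 coef_last_ge0.
Qed.

Lemma poly_bound (l : seq Z) (t : R) : nonneg 5 (shear 1 l) -> 0 <= t <= 1 ->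
  0 <= form l t 1.
Proof.
move=> nl /andP[t0 t1].
have t1' : 0 <= 1 - t by rewrite subr_ge0.
by have := nonneg_form nl t0 t1'; rewrite form_shear ZR1 mul1r addrC subrK.
Qed.

(** For the drift [27/100] the walk reaches the parent with probability
    [27/73 = 0.3698...]; long runs have rates between [0.369] and [0.37], and
    [63/400] is a quarter of [1 - 0.37]. *)
Definition up_rate : R := 369 / 1000.
Definition child_rate : R := 63 / 400.

Lemma sum_coef_le (F t : nat -> R) (th : nat -> R) :
  (forall i, (i <= 3)%N -> 0 <= coef F 3 i) -> (forall i, (i <= 3)%N -> 0 <= F i) ->
  (forall i, (i <= 3)%N -> th i <= t i) ->
  \sum_(i < 4) coef F 3 i * th i * F i <= \sum_(i < 4) coef F 3 i * t i * F i.
Proof.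
move=> cF F0 tht; apply: ler_sum => i _; have i3 : (i <= 3)%N by rewrite -ltnS.
by rewrite ler_wpM2r ?F0 // ler_wpM2l ?cF ?tht.
Qed.

(** One step of the recursion when the generating function at [theta i] is at
    most [T ^ e_i]; the [b_i] are roundings of the [theta i] that keep small the
    coefficients of the polynomial in [T]. *)
Lemma returns_step_rounded n (x T : R) (e : seq nat) (b : seq R) :
  0 < T <= 1 -> 0 <= x <= 1 -> size e = 4 -> sorted leq e ->
  (forall i, (i <= 3)%N -> returns up_rate child_rate n
     (fun l => theta up_rate child_rate x i ^+ l) <= T ^+ nth 0 e i) ->
  (forall i, (i <= 3)%N -> theta up_rate child_rate x i <= nth 0 b i) ->
  returns up_rate child_rate n.+1 (fun k => x ^+ k) <=
    \sum_(i < 4) coef (fun i => T ^+ nth 0 e i) 3 i * nth 0 b i * T ^+ nth 0 e i.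
Proof.
move=> /andP[T0 T1] x01 se so FP thb.
have dec i : (i < 3)%N -> T ^+ nth 0 e i.+1 <= T ^+ nth 0 e i.
  move=> i3; apply: ler_wiXn2l => //; first exact: ltW.
  by apply: (sortedP 0 so); rewrite se.
have cF m i : (i <= m)%N -> (m <= 3)%N -> 0 <= coef (fun i => T ^+ nth 0 e i) m i.
  apply: coef_ge0; rewrite ?exprn_ge0 ?dec ?(ltW T0) //.
  by rewrite exprn_ile1 // ltW.
apply: le_trans (sum_coef_le _ _ thb); last 2 first.
- by move=> i i3; apply: cF.
- by move=> i _; rewrite exprn_ge0 // ltW.
by apply: returns_step => //; rewrite /up_rate /child_rate; try split; lra.
Qed.

Lemma sum_coefE (F t : nat -> R) :
  let c22 := (1 - F 0%N) * (1 + F 0%N - 2 * F 1%N) in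
  \sum_(i < 4) coef F 3 i * t i * F i =
    F 0%N ^+ 3 * t 0%N * F 0%N + 3 * (1 - F 0%N) * F 1%N ^+ 2 * t 1%N * F 1%N
    + 3 * c22 * F 2%N * t 2%N * F 2%N
    + (1 - F 0%N ^+ 3 - 3 * (1 - F 0%N) * F 1%N ^+ 2 - 3 * c22 * F 2%N)
      * t 3%N * F 3%N.
Proof.
have [_ _ _ /= [<- <- <- <-]] := coef_values F.
by rewrite !big_ord_recr big_ord0 /= add0r.
Qed.

(** The exponents [11] and [6] and the two points are found numerically; the
    other exponents are the best integers that Jensen's inequality gives from
    them, or [11] where [theta i <= 27/50]. *)
Lemma returns_decay (rho : R) n : 0 < rho <= 1 -> 249 / 250 <= rho ^+ 11 ->
  returns up_rate child_rate n (fun k => (27 / 50) ^+ k) <= (rho ^+ n) ^+ 11 /\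
  returns up_rate child_rate n (fun k => (19 / 25) ^+ k) <= (rho ^+ n) ^+ 6.
Proof.
move=> /andP[rho0 rho1] rhok.
elim: n => [|n]; first by rewrite !expr0 !expr1n.
have : 0 < rho ^+ n <= 1 by rewrite exprn_gt0 ?exprn_ile1 // ltW.
rewrite [rho ^+ n.+1]exprS; move: (rho ^+ n) => T T01 [IH0 IH1].
have [T0 T1] := andP T01.
have eE : expectation (returns up_rate child_rate n).
  by apply: returns_expectation; rewrite /up_rate /child_rate; try split; lra.
(* The bound by Jensen's inequality, with [th'] a rounding of [th]. *)
have J0 th th' s : (0 < s <= 11)%N -> 0 <= th <= th' ->
    th' ^+ 11 <= (27 / 50) ^+ s ->
    returns up_rate child_rate n (fun l => th ^+ l) <= T ^+ s.
  move=> s11 /andP[th0 le] le'.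
  apply: (expectation_jensen (x := 27 / 50) eE s11 th0 _ T0 _ IH0); first lra.
  by apply: le_trans le'; rewrite lerXn2r ?nnegrE // (le_trans th0).
have J1 th th' s : (0 < s <= 6)%N -> 0 <= th <= th' ->
    th' ^+ 6 <= (19 / 25) ^+ s ->
    returns up_rate child_rate n (fun l => th ^+ l) <= T ^+ s.
  move=> s11 /andP[th0 le] le'.
  apply: (expectation_jensen (x := 19 / 25) eE s11 th0 _ T0 _ IH1); first lra.
  by apply: le_trans le'; rewrite lerXn2r ?nnegrE // (le_trans th0).
split.
- have FP i : (i <= 3)%N -> returns up_rate child_rate n
      (fun l => theta up_rate child_rate (27 / 50) i ^+ l)
      <= T ^+ nth 0%N [:: 4; 7; 11; 11]%N i.
    case: i => [|[|[|[|//]]]] _; rewrite /theta /up_rate /child_rate [nth _ _ _]/=.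
    + by apply: (J1 _ (104 / 125)); [|lra|lra].
    + by apply: (J0 _ (27 / 40)); [|lra|lra].
    + by apply: (J0 _ (27 / 50)); [|lra|lra].
    + by apply: (J0 _ (27 / 50)); [|lra|lra].
  have x01 : 0 <= (27 / 50 : R) <= 1 by lra.
  apply: le_trans (@returns_step_rounded n (27/50) T [:: 4; 7; 11; 11]%N
    [:: 208/250; 169/250; 129/250; 90/250] T01 x01 erefl erefl FP _) _.
    by case=> [|[|[|[|//]]]] _; rewrite /theta /up_rate /child_rate [nth _ _ _]/=; lra.
  (* [250 * (249 / 250 * T ^ 11 - right-hand side) / T ^ 11] *)
  have : 0 <= form [:: 159; 0; 0; 0; 0; -208; 0; 0; 0; 0; -507; -117; 90; 0;
      777; 0; 0; 0; -36; 117; 0; 0; -234]%binZ T 1.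
    by apply: poly_bound; [vm_compute|rewrite (ltW T0)].
  rewrite /form /= !expr1n !mulr1 !ZRp !ZRn !ZR0 /BinPos.Pos.to_nat /=.
  rewrite sum_coefE; cbn [nth] => pos.
  apply: (@le_trans _ _ (249 / 250 * T ^+ 11)); last first.
    by rewrite exprMn ler_wpM2r // exprn_ge0 // ltW.
  have := mulr_ge0 (exprn_ge0 11 (ltW T0)) pos.
  lra.
- have FP i : (i <= 3)%N -> returns up_rate child_rate n
      (fun l => theta up_rate child_rate (19 / 25) i ^+ l)
      <= T ^+ nth 0%N [:: 2; 6; 9; 11]%N i.
    case: i => [|[|[|[|//]]]] _; rewrite /theta /up_rate /child_rate [nth _ _ _]/=.
    + by apply: (J1 _ (114 / 125)); [|lra|lra].
    + by apply: (J1 _ (19 / 25)); [|lra|lra].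
    + by apply: (J0 _ (3 / 5)); [|lra|lra].
    + by apply: (J0 _ (27 / 50)); [|lra|lra].
  have x01 : 0 <= (19 / 25 : R) <= 1 by lra.
  apply: le_trans (@returns_step_rounded n (19/25) T [:: 2; 6; 9; 11]%N
    [:: 228/250; 189/250; 150/250; 110/250] T01 x01 erefl erefl FP _) _.
    by case=> [|[|[|[|//]]]] _; rewrite /theta /up_rate /child_rate [nth _ _ _]/=; lra.
  (* [250 * (249 / 250 * T ^ 6 - right-hand side) / T ^ 6] *)
  have : 0 <= form [:: 249; 0; -228; 0; 0; -110; 0; 0; 0; 0; 0; 110; -1017; 0;
      897; 0; 450; 330; 570; -330; -1560; 0; 660]%binZ T 1.
    by apply: poly_bound; [vm_compute|rewrite (ltW T0)].
  rewrite /form /= !expr1n !mulr1 !ZRp !ZRn !ZR0 /BinPos.Pos.to_nat /=.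
  rewrite sum_coefE; cbn [nth] => pos.
  apply: (@le_trans _ _ (249 / 250 * T ^+ 6)); last first.
    rewrite exprMn ler_wpM2r ?exprn_ge0 ?(ltW T0) //; apply: le_trans rhok _.
    by apply: ler_wiXn2l => //; exact: ltW.
  have := mulr_ge0 (exprn_ge0 6 (ltW T0)) pos.
  lra.
Qed.

End Numerics.

(** * From the game to the frog model *)

Section Activation.
Variables (d : nat) (S : vertex d -> nat -> vertex d).

Definition activated (v : vertex d) := exists n k, age S n v = Some k.

Lemma activated_root : activated [::].
Proof. by exists 0%N, 0%N. Qed.

(** A frog that is woken takes all its steps. *)
Lemma age_reached v : activated v -> forall j, exists n, age S n v = Some j.
Proof.
case=> n [k]; elim: n k => [|n IH] k nk.
  have -> : v = [::] by move: nk => /=; case: eqP.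
  by move=> j; exists j; elim: j => //= j ->.
move: nk => /=; case E: (age S n v) => [k'|]; first by move=> _; exact: IH E.
case: ifP => // act _ j; exists (n.+1 + j)%N.
elim: j => [|j IHj]; first by rewrite addn0 /= E act.
by rewrite addnS; move: IHj; move: (n.+1 + j)%N => m /= ->.
Qed.

Lemma activated_step u j : activated u -> activated (S u j.+1).
Proof.
move=> /age_reached/(_ j)[n nu]; exists n.+1; rewrite /=.
case: (age S n (S u j.+1)) => [k|]; first by exists k.+1.
case: asboolP => [_|[]]; first by exists 0%N.
by exists u, j.
Qed.

Lemma activated_visit u k : activated u -> S u k.+1 = [::] ->
  exists n, root_visit_set S (n, u).
Proof. by move=> /age_reached/(_ k)[n nu] Suk; exists n, k. Qed.

Definition few_visits K : Prop :=
  ~ exists s : seq (nat * vertex d),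
    [/\ uniq s, (K <= size s)%N & forall e, e \in s -> root_visit_set S e].

Lemma root_visits_infinite (R : realType) :
  (forall K, ~ few_visits K) <-> root_visits R S = +oo%E.
Proof.
rewrite /root_visits /counting; case: ifPn => [/asboolP fin|/asboolP inf]; split => //.
- move=> /(_ (size (finmap.enum_fset (fset_set (root_visit_set S)))).+1)[] [s [us]].
  rewrite ltnNge => /negP le sV; apply: le; apply: uniq_leq_size => // e /sV eV.
  by rewrite in_fset_set // inE.
- move=> _ K; apply; have [B BV KB] := infinite_set_fset K inf.
  exists (finmap.enum_fset B); split; [exact: finmap.fset_uniq|exact: KB|].
  by move=> e eB; exact: BV.
Qed.

End Activation.

Section Measurability.
Variables (R : realType) (d : nat) (disp : measure_display).
Variables (T : measurableType disp) (X : vertex d -> nat -> T -> vertex d).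
Hypothesis mX : forall u k w, measurable [set t | X u k t = w].

Let S t := fun v k => X v k t.

Lemma measurable_age n v o : measurable [set t | age (S t) n v = o].
Proof.
elim: n v o => [|n IH] v o /=.
  case: (boolP ((if v == [::] then Some 0%N else None) == o)) => [/eqP e|/eqP e].
    by rewrite (_ : mkset _ = setT) //; apply/seteqP; split.
  by rewrite (_ : mkset _ = set0) //; apply/seteqP; split.
pose hit := \bigcup_(e : vertex d * nat)
  ([set t | age (S t) n e.1 = Some e.2] `&` [set t | X e.1 e.2.+1 t = v]).
have mhit : measurable hit.
  by apply: countable_bigcupT_measurable => // e; exact: measurableI.
have hitP t : `[< exists u k, age (S t) n u = Some k /\ S t u k.+1 = v >] <-> hit t.
  split=> [/asboolP[u [k [nu Su]]]|[[u k] _ [/= nu Su]]]; first by exists (u, k).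
  by apply/asboolP; exists u, k.
case: o => [[|k]|].
- rewrite (_ : mkset _ = [set t | age (S t) n v = None] `&` hit).
    exact: measurableI.
  apply/seteqP; split=> t /=; case E: (age (S t) n v) => [k|//].
  + by [].
  + by case: ifP => // /hitP.
  + by case.
  + by case=> _ /hitP ->.
- rewrite (_ : mkset _ = [set t | age (S t) n v = Some k]) //.
  apply/seteqP; split=> t /=; case: (age (S t) n v) => [k'|] //; try by [case=> ->|].
  by case: ifP.
- rewrite (_ : mkset _ = [set t | age (S t) n v = None] `\` hit).
    exact: measurableD.
  apply/seteqP; split=> t /=; case E: (age (S t) n v) => [k|//].
  + by [].
  + by case: ifP => // /negP nh _; split => // /hitP.
  + by case.
  + by case=> _ nh; case: ifP => // /hitP.
Qed.

Lemma measurable_few_visits K : measurable [set t | few_visits (S t) K].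
Proof.
pose many s := [set t | [/\ uniq s, (K <= size s)%N &
  forall e, e \in s -> root_visit_set (S t) e]].
have -> : [set t | few_visits (S t) K] = ~` \bigcup_s many s.
  apply/seteqP; split=> t /= few.
    by move=> [s _ sP]; apply: few; exists s.
  by move=> [s sP]; apply: few; exists s.
apply: measurableC; apply: countable_bigcupT_measurable; first exact: countableP.
move=> s.
case: (boolP (uniq s && (K <= size s)%N)) => [/andP[us Ks]|/negP bad]; last first.
  rewrite (_ : many s = set0) //; apply/seteqP; split=> t //= [us Ks _].
  by apply: bad; rewrite us Ks.
rewrite (_ : many s = \bigcap_(e in [set` s]) [set t | root_visit_set (S t) e]).
  apply: fin_bigcap_measurable => // e _.
  have -> : [set t | root_visit_set (S t) e] = \bigcup_(k : nat)
      ([set t | age (S t) e.1 e.2 = Some k] `&` [set t | X e.2 k.+1 t = [::]]).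
    by apply/seteqP; split=> t [k] => [[]|_ []]; exists k.
  by apply: bigcupT_measurable => k; apply: measurableI => //; exact: measurable_age.
by apply/seteqP; split=> t /= => [[]|].
Qed.
End Measurability.

Section Histories.
Variables (R : realType) (d : nat) (p : R) (disp : measure_display).
Variables (T : measurableType disp) (P : probability T R).
Variable X : vertex d -> nat -> T -> vertex d.
Hypothesis d_gt0 : (0 < d)%N.
Hypothesis p01 : 0 < p < 1.
Hypothesis frogs : frog_walks p P X.

Let mX u k w : measurable [set t | X u k t = w].
Proof. by have [/(_ u)[]] := frogs. Qed.

Let Pr (A : set T) : R := fine (P A).

Lemma PrE A : measurable A -> P A = (Pr A)%:E.
Proof. by move=> mA; rewrite /Pr fineK // fin_num_measure. Qed.

Lemma Pr_split A B : measurable A -> measurable B -> Pr A = Pr (A `&` B) + Pr (A `\` B).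
Proof.
move=> mA mB; have mI := measurableI _ _ mA mB; have mD := measurableD mA mB.
apply: EFin_inj; rewrite EFinD -(PrE mA) -(PrE mI) -(PrE mD).
by rewrite (measureDI P mA mB) addeC.
Qed.

Lemma Pr_ge0 A : 0 <= Pr A.
Proof. by rewrite /Pr fine_ge0. Qed.

Lemma Pr_sub A B : measurable A -> measurable B -> A `<=` B -> Pr A <= Pr B.
Proof.
by move=> mA mB AB; rewrite -lee_fin -!PrE //; apply: le_measure; rewrite ?inE.
Qed.

(** When the probabilities of the disjoint [D i] add up to that of [C], this
    bounds the probability of [B] within [C].  The function [f] witnesses that
    the [D i] are disjoint. *)
Lemma Pr_cover (I : eqType) (s : seq I) (C B : set T) (D : I -> set T) (f : T -> I) :
  measurable C -> measurable B -> (forall i, measurable (D i)) ->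
  (forall i, i \in s -> D i `<=` C) -> (forall i t, D i t -> f t = i) -> uniq s ->
  Pr (B `&` C) + \sum_(i <- s) Pr (D i) <= Pr C + \sum_(i <- s) Pr (B `&` D i).
Proof.
move=> + mB mD + Df; elim: s C => [|i s IH] C mC DC.
  by move=> _; rewrite !big_nil !addr0; apply: Pr_sub => //; exact: measurableI.
move=> /= /andP[si us]; rewrite !big_cons.
have mBC : measurable (B `&` C) by exact: measurableI.
have DiC : D i `<=` C by apply: DC; exact: mem_head.
have := IH (C `\` D i) (measurableD mC (mD i)) _ us.
rewrite (Pr_split mC (mD i)) (Pr_split mBC (mD i)).
rewrite (_ : C `&` D i = D i); last exact: setIidr.
rewrite -setIA (_ : C `&` D i = D i); last exact: setIidr.
rewrite -setIDA => le.
suff : Pr (B `&` (C `\` D i)) + \sum_(j <- s) Pr (D j) <=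
  Pr (C `\` D i) + \sum_(j <- s) Pr (B `&` D j) by lra.
apply: le => j js t Djt; split; first by apply: (DC j); rewrite // inE js orbT.
by move=> /Df fi; move: js; rewrite -(Df _ _ Djt) fi (negPf si).
Qed.

Definition follows (u : vertex d) (n : nat) (x : nat -> vertex d) : set T :=
  [set t | forall k, (k <= n)%N -> X u k t = x k].

Definition path_prob (n : nat) (x : nat -> vertex d) : R :=
  \prod_(k < n) step_prob p (x k) (x k.+1).

Lemma Pr_follows u n x : x 0%N = u -> P (follows u n x) = (path_prob n x)%:E.
Proof.
move=> xu; have [/(_ u)[_ /(_ n x) ->] _] := frogs.
by rewrite xu eqxx mul1r.
Qed.

Lemma followsS u n x :
  follows u n.+1 x = follows u n x `&` [set t | X u n.+1 t = x n.+1].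
Proof.
apply/seteqP; split=> t /= => [F|[F Fn] k].
  by split => [k kn|]; apply: F => //; exact: leqW.
by rewrite leq_eqVlt => /orP[/eqP->|/F].
Qed.

Lemma follows0 u x : follows u 0 x = [set t | X u 0 t = x 0%N].
Proof.
apply/seteqP; split=> t /= => [F|F k]; first exact: F.
by rewrite leqn0 => /eqP->.
Qed.

Lemma walk_sigma_follows u n x : walk_sigma (X u) (follows u n x).
Proof.
have gen k w : walk_sigma (X u) [set t | X u k t = w].
  by apply: sub_sigma_algebra; exists k, w.
elim: n => [|n IH]; first by rewrite follows0.
rewrite followsS; exact: (@measurableI _ (g_sigma_algebraType
  [set E | exists k w, E = [set t | X u k t = w]]) _ _ IH (gen _ _)).
Qed.

Lemma measurable_follows u n x : measurable (follows u n x).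
Proof.
elim: n => [|n IH]; first by rewrite follows0.
by rewrite followsS; exact: measurableI.
Qed.

Definition history (Vis : seq (vertex d)) (tau : vertex d -> nat)
    (x : vertex d -> nat -> vertex d) : set T :=
  \bigcap_(u in [set` undup Vis]) follows u (tau u) (x u).

Lemma measurable_history Vis tau x : measurable (history Vis tau x).
Proof. by apply: fin_bigcap_measurable => // u _; exact: measurable_follows. Qed.

Lemma Pr_history Vis tau x : (forall u, x u 0%N = u) ->
  Pr (history Vis tau x) = \prod_(u <- undup Vis) path_prob (tau u) (x u).
Proof.
move=> x0; rewrite /Pr /history; have [_ indep] := frogs.
rewrite (indep _ _ (undup_uniq Vis)); last by move=> u _; exact: walk_sigma_follows.
rewrite (eq_bigr (fun u => (path_prob (tau u) (x u))%:E)); last first.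
  by move=> u _; rewrite Pr_follows.
by rewrite prodEFin.
Qed.

Definition extend (x : vertex d -> nat -> vertex d) u n w :=
  fun v k => if (v == u) && (k == n) then w else x v k.

Definition advance (tau : vertex d -> nat) u : vertex d -> nat :=
  fun v => if v == u then (tau u).+1 else tau v.

(** The Markov property of the walks and their independence: given the history,
    the next step of [u] has the law [step_prob].  The frog at the vertex [w]
    just visited joins the history with an empty path, of probability one. *)
Lemma Pr_history_step Vis tau x u w : (forall u, x u 0%N = u) ->
  (forall v, v \notin Vis -> tau v = 0%N) -> u \in Vis ->
  Pr (history (w :: Vis) (advance tau u)
       (extend x u (tau u).+1 w)) =
  Pr (history Vis tau x) * step_prob p (x u (tau u)) w.
Proof.
move=> x0 tau0 uV.
have x0' v : extend x u (tau u).+1 w v 0%N = v by rewrite /extend andbF.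
rewrite !Pr_history //; set tau' := advance tau u; set x' := extend _ _ _ _.
have pu : path_prob (tau' u) (x' u) =
    path_prob (tau u) (x u) * step_prob p (x u (tau u)) w.
  rewrite /path_prob /tau' /advance eqxx big_ord_recr /=; congr (_ * _).
    apply: eq_bigr => k _; have kt := ltn_ord k.
    by rewrite /x' /extend eqxx /= !ltn_eqF // ltnW.
  by rewrite /x' /extend !eqxx /= ltn_eqF.
have pv v : v != u -> path_prob (tau' v) (x' v) = path_prob (tau v) (x v).
  move=> /negPf vu; rewrite /path_prob /tau' /advance vu; apply: eq_bigr => k _.
  by rewrite /x' /extend vu.
have base : \prod_(v <- undup Vis) path_prob (tau' v) (x' v) =
    \prod_(v <- undup Vis) path_prob (tau v) (x v) * step_prob p (x u (tau u)) w.
  rewrite !(bigD1_seq u) ?undup_uniq ?mem_undup //= pu mulrAC; congr (_ * _ * _).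
  by apply: eq_bigr => v vu; exact: pv.
rewrite /=; case: ifPn => wV //; rewrite big_cons base pv; last first.
  by apply: contraNneq wV => ->.
by rewrite /path_prob tau0 // big_ord0 mul1r.
Qed.

Lemma history_step_sub Vis tau x u w : (forall v, v \notin Vis -> tau v = 0%N) ->
  u \in Vis -> forall t,
  history (w :: Vis) (advance tau u) (extend x u (tau u).+1 w) t ->
  history Vis tau x t /\ X u (tau u).+1 t = w.
Proof.
move=> tau0 uV t H.
have F v : v \in Vis -> follows v (advance tau u v) (extend x u (tau u).+1 w v) t.
  move=> vV; apply: H; change (v \in undup (w :: Vis)).
  by rewrite mem_undup inE vV orbT.
split.
  move=> v /=; rewrite mem_undup => vV k kv.
  have := F v vV k; rewrite /extend /advance; case: eqP => [vu|_] /=.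
    by rewrite -vu ltn_eqF // => -> //; exact: leqW.
  exact.
by have := F u uV (tau u).+1; rewrite /extend /advance !eqxx /=; exact.
Qed.

(** Induction on the strategy, conditionally on the history: at a move the
    history splits according to the next step of [u], and when the strategy
    stops with enough frogs returned, these frogs have visited the root. *)
Lemma loss_le_sound K Vis pos q : loss_le p K Vis pos q ->
  forall tau x, (forall u, x u 0%N = u) -> (forall u, pos u = x u (tau u)) ->
  (forall v, v \notin Vis -> tau v = 0%N) ->
  (forall t, history Vis tau x t ->
     forall u, u \in Vis -> activated (fun v k => X v k t) u) ->
  Pr ([set t | few_visits (fun v k => X v k t) K] `&` history Vis tau x) <=
    Pr (history Vis tau x) * q.
Proof.
have mfew := measurable_few_visits mX K; set few := mkset _ in mfew *.
elim=> {Vis pos q} [Vis pos q le|Vis pos u q q' uV _ IH le] tau x x0 posx tau0 act.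
  have mH := measurable_history Vis tau x.
  case: (ltnP (returned Vis pos) K) le => [_ q1|KV q0].
    apply: (@le_trans _ _ (Pr (history Vis tau x))).
      by apply: Pr_sub => //; exact: measurableI.
    by rewrite -[leLHS]mulr1 ler_wpM2l ?Pr_ge0.
  rewrite (_ : few `&` _ = set0); first by rewrite /Pr measure0 mulr_ge0 ?Pr_ge0.
  apply/seteqP; split=> t // [fewt Ht]; apply: fewt.
  pose l := [seq u <- undup Vis | (u != [::]) && (pos u == [::])].
  have /choice[f fP] : forall u, exists n, u \in l ->
      root_visit_set (fun v k => X v k t) (n, u).
    move=> u; case: (boolP (u \in l)) => [|_]; last by exists 0%N.
    rewrite mem_filter mem_undup => /andP[/andP[ur /eqP pu] uV].
    case E: (tau u) (posx u) => [|k].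
      by rewrite x0 pu => e; move: ur; rewrite -e eqxx.
    rewrite pu => xk.
    have [n nu] : exists n, root_visit_set (fun v k => X v k t) (n, u).
      apply: (activated_visit (k := k)); first exact: act uV.
      by rewrite xk; apply: (Ht u); rewrite /= ?mem_undup // E.
    by exists n.
  exists [seq (f u, u) | u <- l]; split.
  - by rewrite map_inj_uniq ?filter_uniq ?undup_uniq // => u v [].
  - by rewrite size_map size_filter.
  - by move=> _ /mapP[u ul ->]; exact: fP.
pose D w := history (w :: Vis) (advance tau u) (extend x u (tau u).+1 w).
have mH := measurable_history Vis tau x.
have mD w : measurable (D w) by exact: measurable_history.
have DX w t : D w t -> history Vis tau x t /\ X u (tau u).+1 t = w.
  exact: history_step_sub.
have uN : uniq (nbrs (pos u)).
  rewrite /nbrs; case: (pos u) => [|j v] /=.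
    by rewrite map_inj_uniq ?enum_uniq // => i i' [].
  rewrite map_inj_uniq ?enum_uniq ?andbT; last by move=> i i' [].
  by apply/mapP => -[i _] /eqP; rewrite eq_sym grandchildNself.
have cover := Pr_cover mH mfew mD (fun w _ t Dw => (DX w t Dw).1)
  (fun w t Dw => (DX w t Dw).2) uN.
have PD w : Pr (D w) = Pr (history Vis tau x) * step_prob p (pos u) w.
  by rewrite posx; exact: Pr_history_step.
have total : \sum_(w <- nbrs (pos u)) Pr (D w) = Pr (history Vis tau x).
  rewrite (eq_bigr _ (fun w _ => PD w)) -mulr_sumr.
  rewrite (eq_bigr (fun w => step_prob p (pos u) w * 1)); last first.
    by move=> w _; rewrite mulr1.
  by rewrite -/(move p (pos u) (fun=> 1)) move_const // mulr1.
have step : Pr (few `&` history Vis tau x) <=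
    \sum_(w <- nbrs (pos u)) Pr (few `&` D w) by rewrite total in cover; lra.
apply: le_trans step _.
apply: (@le_trans _ _ (Pr (history Vis tau x) * move p (pos u) q)); last first.
  by rewrite ler_wpM2l ?Pr_ge0.
rewrite /move mulr_sumr; apply: ler_sum => w _; rewrite mulrA -PD; apply: IH.
- by move=> v; rewrite /extend andbF.
- move=> v; rewrite /relocate /advance /extend.
  case: eqP => [->|_] /=; last exact: posx.
  by rewrite eqxx.
- move=> v; rewrite inE negb_or => /andP[vw vV]; rewrite /advance.
  by case: eqP => [vu|_]; [move: vV; rewrite vu uV|exact: tau0].
- move=> t /DX[Ht Xt] v; rewrite inE => /orP[/eqP->|]; last exact: act.
  by rewrite -Xt; apply: (@activated_step _ (fun v k => X v k t)); exact: act.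
Qed.

Lemma recurrent_of_loss0 : (forall K, loss p K [:: [::] : vertex d] id = 0) ->
  P [set t | root_visits R (fun v k => X v k t) = +oo%E] = 1%E.
Proof.
move=> loss0; pose few K := [set t | few_visits (fun v k => X v k t) K].
have mfew K : measurable (few K) by exact: measurable_few_visits.
have few0 K : P (few K) = 0%E.
  pose H := history [:: [::] : vertex d] (fun=> 0%N) (fun u _ => u).
  have mH : measurable H by exact: measurable_history.
  have H1 : P H = 1%E.
    rewrite (PrE mH) /H Pr_history // big_seq1 /path_prob big_ord0 //.
  have H0 : P (few K `\` H) = 0%E.
    apply/eqP; rewrite eq_le measure_ge0 andbT.
    have : (P (few K `\` H) <= P (~` H))%E.
      by apply: le_measure; rewrite ?inE; [exact: measurableD|exact: measurableC|].
    by rewrite probability_setC // H1 subee.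
  have FH : Pr (few K `&` H) = 0.
    apply: le_anti; rewrite Pr_ge0 andbT -(loss0 K).
    apply/ler_addgt0Pr => e e0.
    have [q qP qe] := loss_approx d_gt0 p01 K [:: [::]] id e0.
    apply: le_trans qe; rewrite -[q]mul1r -[1](_ : Pr H = 1); last by rewrite /Pr H1.
    apply: loss_le_sound qP _ _ _ _ _ _ => // t _ u; rewrite inE => /eqP->.
    exact: activated_root.
  have mI := measurableI _ _ (mfew K) mH.
  have -> : P (few K) = (P (few K `\` H) + P (few K `&` H))%E.
    exact: measureDI.
  by rewrite H0 add0e (PrE mI) FH.
have -> : [set t | root_visits R (fun v k => X v k t) = +oo%E] = ~` \bigcup_K few K.
  apply/seteqP; split=> t /=.
    by move=> /root_visits_infinite inf [K _ fewK]; exact: inf fewK.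
  by move=> nfew; apply/root_visits_infinite => K fewK; apply: nfew; exists K.
have mU : measurable (\bigcup_K few K) by exact: bigcupT_measurable.
rewrite probability_setC // (_ : P _ = 0%E) ?sube0 //.
apply: (measure_negligible mU); apply: negligible_bigcup => K.
by apply/(negligibleP P (mfew K)); exact: few0.
Qed.

End Histories.

(** * Recurrence *)

Section Recurrence.
Variables (R : realType) (d : nat).
Hypothesis d_ge4 : (4 <= d)%N.

Let p : R := 27 / 100.

Let p01 : 0 < p < 1. Proof. by rewrite /p; lra. Qed.

Lemma up_prob_ge (a b : R) n : 0 <= b -> a <= up_prob p n ->
  b * (1 - 73 / 100 * a) <= p -> b <= up_prob p n.+1.
Proof.
move=> b0 an; have /andP[h0 h1] := up_prob_bound p01 n.
move: an; rewrite /= /p; move: (up_prob _ n) h0 h1 => h h0 h1 an le.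
by rewrite ler_pdivlMr; [nra|lra].
Qed.

Lemma up_rate_le n : (6 <= n)%N -> up_rate R <= up_prob p n.
Proof.
move=> n6; rewrite -(subnK n6) /up_rate; elim: (n - 6)%N => [|m IH]; last first.
  by rewrite addSn; apply: (up_prob_ge _ IH); rewrite /p; lra.
(* six generations bring the ruin probability above 0.369 *)
have h1 : 27 / 100 <= up_prob p 1.
  by apply: (@up_prob_ge 0); rewrite /p /=; lra.
have h2 : 336 / 1000 <= up_prob p 2 by apply: (up_prob_ge _ h1); rewrite /p; lra.
have h3 : 357 / 1000 <= up_prob p 3 by apply: (up_prob_ge _ h2); rewrite /p; lra.
have h4 : 365 / 1000 <= up_prob p 4 by apply: (up_prob_ge _ h3); rewrite /p; lra.
have h5 : 368 / 1000 <= up_prob p 5 by apply: (up_prob_ge _ h4); rewrite /p; lra.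
by apply: (up_prob_ge _ h5); rewrite /p; lra.
Qed.

Lemma child_rate_le n : 4 * child_rate R <= 1 - up_prob p n.
Proof.
suff : 0 <= up_prob p n <= 37 / 100 by rewrite /child_rate; lra.
elim: n => [|n /andP[h0 h1]]; first by rewrite /=; lra.
have /andP[-> _] := up_prob_bound p01 n.+1.
move: h0 h1; rewrite /= /p; move: (up_prob _ n) => h h0 h1.
by rewrite ler_pdivrMr; lra.
Qed.

Lemma loss_eq0 K : loss p K [:: [::] : vertex d] id = 0.
Proof.
have d_gt0 : (0 < d)%N by exact: leq_trans d_ge4.
apply: le_anti; rewrite (loss_ge0 d_gt0 p01) andbT.
pose x : R := 27 / 50; pose rho : R := 2749 / 2750.
have x0 : 0 < x ^+ K by rewrite exprn_gt0 // /x; lra.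
have bound n : loss p K [:: [::] : vertex d] id <= rho ^+ n / x ^+ K.
  have h0 : 0 <= up_rate R by rewrite /up_rate; lra.
  have w0 : 0 <= child_rate R by rewrite /child_rate; lra.
  apply: le_trans (loss_le_returns K d_ge4 p01 w0 h0 up_rate_le
    (fun n _ => child_rate_le n) n) _.
  have eE : expectation (returns (up_rate R) (child_rate R) n).
    by apply: returns_expectation; rewrite /up_rate /child_rate; try split; lra.
  have [_ mono _] := eE.
  apply: le_trans (_ : _ <= returns (up_rate R) (child_rate R) n
      (fun k => (x ^+ K)^-1 * x ^+ k)) _.
    apply: mono => k; case: ltnP => [kK|_]; last first.
      by rewrite mulr_ge0 ?invr_ge0 ?exprn_ge0 ?(ltW x0) // /x; lra.
    rewrite mulrC ler_pdivlMr // mul1r.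
    by apply: ler_wiXn2l; rewrite ?(ltnW kK) // /x; lra.
  rewrite expectation_scale // mulrC ler_pM2r ?invr_gt0 //.
  have rho01 : 0 < rho <= 1 by rewrite /rho; lra.
  have rho11 : 249 / 250 <= rho ^+ 11 by rewrite /rho; lra.
  have [le _] := returns_decay n rho01 rho11; apply: le_trans le _.
  have /andP[r0 r1] : 0 <= rho ^+ n <= 1.
    by rewrite exprn_ge0 ?exprn_ile1 //; case/andP: rho01 => // /ltW.
  by rewrite -[leRHS]expr1; apply: ler_wiXn2l.
apply/ler_addgt0Pr => e e0; rewrite add0r.
have rho1 : `|rho| < 1 by rewrite ger0_norm /rho; lra.
have := cvg_expr rho1 => /cvgrPdist_lt/(_ (e * x ^+ K)).
rewrite mulr_gt0 // => /(_ isT)[n _ /(_ n (leqnn n))] /=.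
rewrite sub0r normrN => near; apply: le_trans (bound n) _.
rewrite ler_pdivrMr //; apply: le_trans (ltW near); exact: ler_norm.
Qed.

Lemma recurrent_27_100 : recurrent d p.
Proof.
move=> disp T P X frogs; apply: (recurrent_of_loss0 _ p01 frogs) => //.
- by exact: leq_trans d_ge4.
- exact: loss_eq0.
Qed.

End Recurrence.

Theorem theorem2 (R : realType) :
  (ereal_sup [set critical_drift R d | d in [set d : nat | (4 <= d)%N]]
     <= (27 / 100 : R)%:E)%E.
Proof.
apply: ge_ereal_sup => _ [d d4 <-]; apply: ereal_inf_lbound.
exists (27 / 100) => //; split; first by lra.
exact: recurrent_27_100.
Qed.
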